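(* Let $(X,\|\cdot\|_X)$ and $(Y,\|\cdot\|_Y)$ be real Banach spaces and let $f:X\to Y$ be a locally Lipschitz map with a pseudo-Jacobian mapping $Jf$ that is regular at every $x\in X$ and satisfies the strong chain rule condition on $X$. Suppose that for some $y\in Y$ the locally Lipschitz functional $F_y(x)=\|f(x)-y\|_Y$ satisfies the weighted Chang-Palais-Smale condition with respect to some weight $h$. Then there exists a unique solution $x\in X$ of the nonlinear equation $f(x)=y$.
   Context: Notation: $B(x;r)$ is the open ball of center $x$ and radius $r$; $L(X,Y)$ is the space of bounded linear operators from $X$ to $Y$ with the operator norm; $X^*=L(X,\mathbb R)$; $\mathrm{co}$ is the convex hull and $\overline{\mathrm{co}}$ the closed convex hull (closure in operator norm). Pseudo-Jacobian: for $\phi:X\to\mathbb R$, $\phi'_+(x;v)=\limsup_{t\to0^+}\frac{\phi(x+tv)-\phi(x)}{t}$. For a continuous map $f:X\to Y$, a nonempty set $Jf(x)\subset L(X,Y)$ is a pseudo-Jacobian of $f$ at $x$ if for every $y^*\in Y^*$ and $v\in X$, $(y^*\circ f)'_+(x;v)\le\sup\{\langle y^*,T(v)\rangle: T\in Jf(x)\}$. A pseudo-Jacobian mapping for $f$ on $X$ (also just called a pseudo-Jacobian $Jf$) is a set-valued map $Jf:X\to2^{L(X,Y)}$ such that $Jf(x)$ is a pseudo-Jacobian of $f$ at $x$ for every $x\in X$. The same definition with $Y=\mathbb R$ applies to real-valued functions. Write $Jf(A)=\bigcup_{z\in A}Jf(z)$. Clarke subdifferential: for $\phi:X\to\mathbb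 R$ locally Lipschitz, $\phi^\circ(x;v)=\limsup_{z\to x,\,t\to0^+}\frac{\phi(z+tv)-\phi(z)}{t}$ and $\partial\phi(x)=\{x^*\in X^*: x^*(v)\le\phi^\circ(x;v)\text{ for all }v\in X\}$, a nonempty $w^*$-compact convex set. Strong chain rule condition: for $y\in Y$ let $F_y(x)=\|f(x)-y\|_Y$. For $x\in X$ and $y\ne f(x)$ let $$\Delta F_y(x)=\partial\|\cdot\|_Y(f(x)-y)\circ\overline{\mathrm{co}}(Jf(x))=\{y^*\circ T:\ y^*\in\partial\|\cdot\|_Y(f(x)-y),\ T\in\overline{\mathrm{co}}(Jf(x))\}\subset X^*.$$ $Jf$ satisfies the strong chain rule condition on $X$ if $f$ is locally Lipschitz and, for each $x\in X$ and each $y\neq f(x)$, the set $\Delta F_y(x)$ is $w^*$-closed and convex in $X^*$, is a pseudo-Jacobian of $F_y$ at $x$, and contains the Clarke subdifferential $\partial F_y(x)$. Regularity: for $T\in L(X,Y)$ let $C(T)=\inf_{\|v^*\|_{Y^*}=1}\|T^*v^*\|_{X^*}$ and $C^*(T)=\inf_{\|u\|_X=1}\|Tu\|_Y$. (If $T$ is an isomorphism, $C(T)=C^*(T)=\|T^{-1}\|^{-1}$.) Define $$\mathrm{Sur}\,Jf(x)=\sup_{r>0}\inf\{C(T): T\in\mathrm{co}\,Jf(B(x;r))\},\qquad \mathrm{Inj}\,Jf(x)=\sup_{r>0}\inf\{C^*(T): T\in\mathrm{co}\,Jf(B(x;r))\}.$$ $Jf$ is regular at $x_0$ if, for some $r>0$,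 every $T\in\mathrm{co}\,Jf(B(x_0;r))$ is an isomorphism from $X$ onto $Y$ and $\mathrm{Reg}\,Jf(x_0)>0$, where $\mathrm{Reg}\,Jf(x_0):=\mathrm{Sur}\,Jf(x_0)=\mathrm{Inj}\,Jf(x_0)$ is the regularity index (the two quantities coincide when the operators in $\mathrm{co}\,Jf(B(x_0;r))$ are isomorphisms). Weighted Chang-Palais-Smale condition: a weight is a continuous nondecreasing function $h:[0,\infty)\to[0,\infty)$ with $\int_0^\infty\frac{1}{1+h(\rho)}\,d\rho=\infty$. For a locally Lipschitz $F:X\to\mathbb R$ put $\lambda_F(x)=\min_{w^*\in\partial F(x)}\|w^*\|_{X^*}$. $F$ satisfies the weighted Chang-Palais-Smale condition with respect to $h$ if every sequence $\{x_n\}\subset X$ such that $\{F(x_n)\}$ is bounded and $\lim_{n\to\infty}\lambda_F(x_n)(1+h(\|x_n\|_X))=0$ contains a (norm-)convergent subsequence. Locally Lipschitz: every point has a neighborhood on which the map is Lipschitz. *)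

(* Defs.v *)
(* Banach spaces are completeNormedModType R with R : realType. *)
From HB Require Import structures.
From mathcomp Require Import all_boot all_order all_algebra.
From mathcomp Require Import all_classical all_reals all_analysis.
Set Implicit Arguments.
Unset Strict Implicit.
Unset Printing Implicit Defensive.
Import Order.TTheory GRing.Theory Num.Theory.
Import numFieldNormedType.Exports.
Local Open Scope classical_set_scope.
Local Open Scope ring_scope.

Section BoundedOperators.
Context {R : realType} (X Y : normedModType R).

Definition bounded_operator (f : X -> Y) :=
  linear f /\ exists M : R, forall x, `|f x| <= M * `|x|.

Definition bounded_operator_pred : {pred X -> Y} :=
  [pred f | `[< bounded_operator f >]].

Record blin := BLin {
  blin_fun :> X -> Y ;
  blin_funP : blin_fun \in bounded_operator_pred
}.

HB.instance Definition _ := [isSub for blin_fun].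
HB.instance Definition _ := [Choice of blin by <:].

Lemma bounded_operatorP (f : X -> Y) :
  reflect (bounded_operator f) (f \in bounded_operator_pred).
Proof. exact: asboolP. Qed.

Lemma bounded_operator_pred_submod : submod_closed bounded_operator_pred.
Proof.
split.
  apply/bounded_operatorP; split; first by move=> a u v /=; rewrite scaler0 addr0.
  by exists 0 => x; rewrite normr0 mul0r.
move=> a f g /bounded_operatorP[lf [M fM]] /bounded_operatorP[lg [N gN]].
apply/bounded_operatorP; split.
  move=> b u v; rewrite !fctE lf lg !scalerDr !scalerA (mulrC a b).
  by rewrite addrACA.
exists (`|a| * M + N) => x; rewrite !fctE mulrDl.
rewrite (le_trans (ler_normD _ _))// lerD// normrZ -mulrA.
by rewrite ler_wpM2l.
Qed.

HB.instance Definition _ :=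
  GRing.isSubmodClosed.Build R (X -> Y) bounded_operator_pred
    bounded_operator_pred_submod.
HB.instance Definition _ := [SubChoice_isSubLmodule of blin by <:].

Lemma blin_linear (T : blin) : linear T.
Proof. by have /bounded_operatorP[] := blin_funP T. Qed.

HB.instance Definition _ (T : blin) :=
  GRing.isLinear.Build R X Y *:%R T (@blin_linear T).

Lemma blin_ext (S T : blin) : S =1 T -> S = T.
Proof. by move=> ST; apply: val_inj; apply: funext. Qed.

Definition opnorm (T : blin) : R :=
  sup [set `|T x| | x in [set x : X | `|x| <= 1]].

Lemma opnorm_has_sup (T : blin) :
  has_sup [set `|T x| | x in [set x : X | `|x| <= 1]].
Proof.
split; first by exists `|T 0|, 0 => //=; rewrite normr0.
have /bounded_operatorP[_ [M TM]] := blin_funP T.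
exists `|M| => _ [x /= x1 <-]; apply: (le_trans (TM x)).
rewrite (le_trans (ler_wpM2r _ (ler_norm M)))//.
by rewrite -[leRHS]mulr1 ler_wpM2l.
Qed.

Lemma opnormP (T : blin) x : `|T x| <= opnorm T * `|x|.
Proof.
have [->|x0] := eqVneq x 0; first by rewrite linear0 !normr0 mulr0.
have nx : 0 < `|x| by rewrite normr_gt0.
have -> : `|T x| = `|T (`|x|^-1 *: x)| * `|x|.
  by rewrite linearZ/= normrZ normfV normr_id mulrAC mulVf ?mul1r// gt_eqF.
rewrite ler_wpM2r//; apply: ub_le_sup; first exact: (opnorm_has_sup T).2.
by exists (`|x|^-1 *: x) => //=; rewrite normrZ normfV normr_id mulVf// gt_eqF.
Qed.

Lemma opnorm_le (T : blin) M : 0 <= M ->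
  (forall x, `|T x| <= M * `|x|) -> opnorm T <= M.
Proof.
move=> M0 TM; apply: ge_sup; first exact: (opnorm_has_sup T).1.
move=> _ [x /= x1 <-]; apply: (le_trans (TM x)).
by rewrite -[leRHS]mulr1 ler_wpM2l.
Qed.

Lemma opnorm_ge0 (T : blin) : 0 <= opnorm T.
Proof.
apply: ub_le_sup; first exact: (opnorm_has_sup T).2.
by exists 0; rewrite /= ?linear0 ?normr0.
Qed.

Lemma opnormD (S T : blin) : opnorm (S + T) <= opnorm S + opnorm T.
Proof.
apply: opnorm_le => [|x]; first by rewrite addr_ge0 ?opnorm_ge0.
by rewrite mulrDl (le_trans (ler_normD _ _))// lerD ?opnormP.
Qed.

Lemma opnormZ a (T : blin) : opnorm (a *: T) = `|a| * opnorm T.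
Proof.
have le b S : opnorm (b *: S) <= `|b| * opnorm S.
  apply: opnorm_le => [|x]; first by rewrite mulr_ge0 ?opnorm_ge0.
  by rewrite [leLHS]normrZ -mulrA ler_wpM2l// opnormP.
apply/eqP; rewrite eq_le le/=.
have [->|a0] := eqVneq a 0; first by rewrite normr0 mul0r opnorm_ge0.
rewrite -ler_pdivlMl ?normr_gt0// -normfV.
by rewrite (le_trans _ (le _ _))// scalerA mulVf// scale1r.
Qed.

Lemma opnorm0_eq0 (T : blin) : opnorm T = 0 -> T = 0.
Proof.
move=> T0; apply: blin_ext => x; apply/eqP.
by rewrite -normr_le0 (le_trans (opnormP T x))// T0 mul0r.
Qed.

HB.instance Definition _ :=
  Lmodule_isNormed.Build R blin opnormD opnormZ opnorm0_eq0.

Lemma blin_normE (T : blin) :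
  `|T| = sup [set `|T x| | x in [set x : X | `|x| <= 1]].
Proof. by []. Qed.

End BoundedOperators.

Section Composition.
Context {R : realType} (X Y Z : normedModType R).

Lemma blin_comp_subproof (S : blin Y Z) (T : blin X Y) :
  (S \o T : X -> Z) \in @bounded_operator_pred R X Z.
Proof.
apply/bounded_operatorP; split.
  by move=> a u v; rewrite /= !linearP.
exists (opnorm S * opnorm T) => x /=; rewrite (le_trans (opnormP S _))// -mulrA.
by rewrite ler_wpM2l ?opnormP ?opnorm_ge0.
Qed.

Definition blin_comp (S : blin Y Z) (T : blin X Y) : blin X Z :=
  BLin (blin_comp_subproof S T).

End Composition.

(* The dual of X is blin X R^o, and the adjoint T^* maps ys to blin_comp ys T. *)

Definition convex_hull {R : realType} {E : lmodType R} (A : set E) : set E :=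
  smallest (@convex_set R E) A.

Definition weak_star_closed {R : realType} {X : normedModType R}
    (A : set (blin X R^o)) :=
  closed (A : set (initial_topology
    (fun xs : blin X R^o => (xs : X -> R^o) : {ptws X -> R^o}))).

Definition locally_lipschitz {R : realType} {X Y : normedModType R}
    (f : X -> Y) :=
  forall x : X, exists2 U, nbhs x U & exists k : R, k.-lipschitz_U f.

Section Subdifferentials.
Context {R : realType} {X : normedModType R}.
Implicit Types (phi : X -> R) (x v : X).
Local Open Scope ereal_scope.

Definition upper_dini phi x v : \bar R :=
  limf_esup (fun t : R => ((phi (x + t *: v) - phi x) / t)%:E) 0%R^'+.

Definition clarke_derivative phi x v : \bar R :=
  limf_esup (fun zt : X * R => ((phi (zt.1 + zt.2 *: v) - phi zt.1) / zt.2)%:E)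
    (filter_prod (nbhs x) 0%R^'+).

Definition clarke_subdifferential phi x : set (blin X R^o) :=
  [set xs | forall v, (xs v)%:E <= clarke_derivative phi x v].

(* For locally Lipschitz phi this set is nonempty and weak-* compact, so the
   infimum is a minimum. *)
Definition clarke_slope phi x : R :=
  inf [set `|xs|%R | xs in clarke_subdifferential phi x].

End Subdifferentials.

Section PseudoJacobians.
Context {R : realType} {X Y : normedModType R}.
Implicit Types (f : X -> Y) (J : X -> set (blin X Y)) (T : blin X Y).

Definition pseudo_jacobian_at f x (A : set (blin X Y)) :=
  A !=set0 /\
  forall (ys : blin Y R^o) (v : X),
    (upper_dini (ys \o f) x v <= ereal_sup [set (ys (T v))%:E | T in A])%E.

Definition pseudo_jacobian_map f J := forall x, pseudo_jacobian_at f x (J x).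

Definition dist_to f (y : Y) : X -> R := fun x => `|f x - y|.

Definition chain_set f J (y : Y) (x : X) : set (blin X R^o) :=
  [set blin_comp ys T |
    ys in clarke_subdifferential (fun z : Y => `|z|) (f x - y) &
    T in closure (convex_hull (J x))].

(* Extended-real infima: on a trivial space the unit sphere is empty and the
   index is +oo. *)
Definition surj_modulus T : \bar R :=
  ereal_inf [set `|blin_comp vs T|%:E | vs in [set vs : blin Y R^o | `|vs| = 1]].

Definition inj_modulus T : \bar R :=
  ereal_inf [set `|T u|%:E | u in [set u : X | `|u| = 1]].

Definition hull_near J (x : X) (r : R) : set (blin X Y) :=
  convex_hull (\bigcup_(z in ball x r) J z).

Definition sur J x : \bar R :=
  ereal_sup [set ereal_inf [set surj_modulus T | T in hull_near J x r] |
             r in [set r | 0 < r]].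

Definition inj J x : \bar R :=
  ereal_sup [set ereal_inf [set inj_modulus T | T in hull_near J x r] |
             r in [set r | 0 < r]].

Definition isomorphism T :=
  exists S : blin Y X, cancel T S /\ cancel S T.

(* Equal to inj J x as soon as hull_near J x r consists of isomorphisms for
   some r > 0, which is the only case in which it is used. *)
Definition reg J x : \bar R := sur J x.

Definition regular_at J x :=
  (exists2 r : R, 0 < r & forall T, hull_near J x r T -> isomorphism T) /\
  (0 < reg J x)%E.

End PseudoJacobians.

Definition strong_chain_rule {R : realType} {X Y : normedModType R}
    (f : X -> Y) (J : X -> set (blin X Y)) :=
  locally_lipschitz f /\
  forall x y, y <> f x ->
    [/\ weak_star_closed (chain_set f J y x),
        convex_set (chain_set f J y x),
        pseudo_jacobian_at (dist_to f y : X -> R^o) x (chain_set f J y x) &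
        clarke_subdifferential (dist_to f y) x `<=` chain_set f J y x].

(* Only the restriction of h to [0, +oo[ matters. *)
Definition weight {R : realType} (h : R -> R) :=
  [/\ {within `[0, +oo[, continuous h},
      {in `[0, +oo[ &, {homo h : a b / a <= b}},
      forall a : R, 0 <= a -> 0 <= h a &
      (\int[lebesgue_measure]_(a in `[0%R, +oo[) ((1 + h a)^-1)%:E)%E = +oo%E].

Definition weighted_CPS {R : realType} {X : normedModType R}
    (F : X -> R) (h : R -> R) :=
  forall u : nat -> X,
    (exists M, forall n, `|F (u n)| <= M) ->
    (fun n => clarke_slope F (u n) * (1 + h `|u n|)) @ \oo --> (0 : R) ->
    exists2 s : nat -> nat, {homo s : m n / (m < n)%N} &
      exists l : X, u (s n) @[n --> \oo] --> l.

(* Main.v *)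
Require Import Defs.
From mathcomp Require Import all_boot all_order all_algebra.
From mathcomp Require Import all_classical all_reals all_analysis.
From mathcomp Require Import measurable_realfun ring lra.
Import Order.TTheory GRing.Theory Num.Theory.
Import numFieldNormedType.Exports.
Local Open Scope classical_set_scope.
Local Open Scope ring_scope.

(* Let F x = |f x - y|.  Where F > 0, the strong chain rule writes every Clarke
   subgradient of F as ys o T with |ys| >= 1 and T in the closed hull of Jf, so
   regularity bounds the Clarke slope of F away from 0 locally.  Together with
   the weighted Chang-Palais-Smale condition this forces every level of F that
   carries almost critical points to be 0.  A min-max over paths produces almost
   critical points: with trivial paths the level is inf F, which gives a
   solution; for paths joining two distinct solutions x1 and x2 the level is
   positive, because F x = |f x - f x1| >= c |x - x1| near x1 (mean value
   inequality for pseudo-Jacobians) and every path crosses a small sphere around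
   x1, which gives uniqueness. *)

(** * The Hahn-Banach theorem *)

(** The Palais-Smale condition controls only the slope multiplied by [1 + h |x|], so the min-max has
    to produce points where this product is small without knowing in advance how far out they lie.
    Moving from radius [r] to [r + s] is charged, up to a factor [e], with the increment of the
    integral of [1 / (1 + h)]. This charge is at most [s / (1 + h r)], which is just what a
    deformation of length [s] gains on a path inside radius [r] when no almost critical point lies
    near its top.

    Hahn-Banach is stated for a cone of prescribed lower bounds because three separations are
    instances of it: a small subgradient when no direction descends fast enough, a norming
    functional, and one functional that is uniformly negative on all [T v] with [T] in a convex
    hull. Subgradients come directly from it, so weak-star compactness of the subdifferential is
    never invoked. *)

Section Sandwich.
Context {R : realType} {E : lmodType R}.
Implicit Types (q : E -> R) (P : set (E * R)).

Definition sublinear q :=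
  (forall x y, q (x + y) <= q x + q y) /\
  (forall a x, 0 <= a -> q (a *: x) <= a * q x).

(** A pair [(x, a)] of [P] encodes the demand [a <= L x] on a linear functional [L] still to be
    found. *)
Definition convex_cone P :=
  [/\ P (0, 0), (forall u v, P u -> P v -> P (u + v)) &
      (forall a u, 0 <= a -> P u -> P (a *: u.1, a * u.2))].

Lemma sublinear0 q : sublinear q -> q 0 = 0.
Proof.
move=> [qD qZ]; apply/eqP; rewrite eq_le; apply/andP; split.
  by have := qZ 0 0 (lexx _); rewrite scaler0 mul0r.
by have := qD 0 0; rewrite addr0; lra.
Qed.

Lemma sublinearN q x : sublinear q -> - q (- x) <= q x.
Proof.
by move=> sq; have := sq.1 x (- x); rewrite subrr sublinear0//; lra.
Qed.

(** When [P] is a cone with [u.2 <= q u.1] on it, a linear functional lies below this function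
    exactly when it lies below [q] and meets all the demands in [P]: take [u = (0, 0)] for the
    former and [x = - u.1] for the latter. *)
Definition cone_reduction q P (x : E) : R :=
  inf [set q (x + u.1) - u.2 | u in P].

Lemma cone_reduction_lbound q P x : sublinear q ->
  (forall u, P u -> u.2 <= q u.1) ->
  lbound [set q (x + u.1) - u.2 | u in P] (- q (- x)).
Proof.
move=> sq Pq _ [u Pu <-]; have := Pq _ Pu.
have := sq.1 (x + u.1) (- x).
by rewrite [x + _]addrC addrK; lra.
Qed.

Lemma cone_reduction_le q P x u : sublinear q ->
  (forall u, P u -> u.2 <= q u.1) -> P u ->
  cone_reduction q P x <= q (x + u.1) - u.2.
Proof.
move=> sq Pq Pu; apply: ge_inf; last by exists u.
by exists (- q (- x)); exact: cone_reduction_lbound.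
Qed.

Lemma sublinear_cone_reduction q P : sublinear q -> convex_cone P ->
  (forall u, P u -> u.2 <= q u.1) -> sublinear (cone_reduction q P).
Proof.
move=> sq [P0 PD PZ] Pq.
have ne x : [set q (x + u.1) - u.2 | u in P] !=set0.
  by exists (q (x + 0) - 0), (0, 0).
split=> [x y|a x a0].
  apply/ler_addgt0Pr => e e0; have e2 : 0 < e / 2 by rewrite divr_gt0.
  have [_ [u Pu <-] ux] := inf_lt (ne x) (ltr_pwDr e2 (lexx _)).
  have [_ [v Pv <-] vx] := inf_lt (ne y) (ltr_pwDr e2 (lexx _)).
  have := cone_reduction_le q P (x + y) (u + v) sq Pq (PD _ _ Pu Pv).
  have := sq.1 (x + u.1) (y + v.1); rewrite addrACA /=.
  by move: ux vx; rewrite -!/(cone_reduction _ _ _); lra.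
have [->|a00] := eqVneq a 0.
  rewrite scale0r mul0r.
  have := cone_reduction_le q P 0 (0, 0) sq Pq P0.
  by rewrite /= addr0 (sublinear0 q)// subr0.
have agt0 : 0 < a by rewrite lt_neqAle eq_sym a00.
rewrite -ler_pdivrMl//; apply: lb_le_inf => // _ [u Pu <-].
rewrite ler_pdivrMl//.
have := cone_reduction_le q P (a *: x) _ sq Pq (PZ _ _ a0 Pu).
rewrite /= -scalerDr; have := sq.2 a (x + u.1) a0; lra.
Qed.

(** Zorn's lemma for the reversed pointwise order: a nonempty chain is bounded by its pointwise
    infimum. *)
Lemma sublinear_minorant q : sublinear q ->
  exists L : E -> R, [/\ sublinear L, (forall x, L x <= q x) &
    forall p, sublinear p -> (forall x, p x <= L x) -> p = L].
Proof.
move=> sq; pose T := {p : E -> R | sublinear p /\ forall x, p x <= q x}.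
pose le (p1 p2 : T) := `[< forall x, sval p2 x <= sval p1 x >].
have [||||[L [sL Lq]] Lmin] := @Zorn T le.
- by move=> p; apply/asboolP.
- by move=> p1 p2 p3 /asboolP h1 /asboolP h2; apply/asboolP => x;
    exact: le_trans (h2 x) (h1 x).
- move=> [p1 h1] [p2 h2] /asboolP /= h12 /asboolP /= h21.
  apply: eq_exist => /=; apply: funext => x; apply/eqP.
  by rewrite eq_le h12 h21.
- move=> A totA; have [[p0 Ap0]|A0] := pselect (A !=set0); last first.
    by exists (exist _ q (conj sq (fun x => lexx _))) => p Ap; case: A0; exists p.
  (* The infimum is finite because [p x >= - p (- x) >= - q (- x)] for each sublinear [p <= q]. *)
  have lb x : lbound [set sval p x | p in A] (- q (- x)).
    move=> _ [[p [sp pq]] /= Ap <-]; have := sublinearN p x sp.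
    by have := pq (- x); lra.
  have ne x : [set sval p x | p in A] !=set0 by exists (sval p0 x), p0.
  pose m x := inf [set sval p x | p in A].
  have mle p x : A p -> m x <= sval p x.
    by move=> Ap; apply: ge_inf; [exists (- q (- x)); exact: lb | exists p].
  have mP : sublinear m /\ forall x, m x <= q x.
    split; last by move=> x; apply: le_trans (mle p0 x Ap0) _; case: (svalP p0).
    split=> [x y|a x a0].
      apply/ler_addgt0Pr => e e0; have e2 : 0 < e / 2 by rewrite divr_gt0.
      have [_ [u Pu <-] ux] := inf_lt (ne x) (ltr_pwDr e2 (lexx _)).
      have [_ [v Pv <-] vx] := inf_lt (ne y) (ltr_pwDr e2 (lexx _)).
      (* In a chain, the smaller of [u] and [v] is nearly optimal at [x] and at [y]
         simultaneously. *)
      have [w [Aw wu wv]] : exists w, [/\ A w, sval w x <= sval u x &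
          sval w y <= sval v y].
        by case: (totA _ _ Pu Pv) => /asboolP h; [exists v|exists u]; split.
      have [[wD _] _] := svalP w.
      have := wD x y; have := mle w (x + y) Aw.
      by move: ux vx; rewrite -!/(m _); lra.
    have [->|a00] := eqVneq a 0.
      rewrite scale0r mul0r; apply: le_trans (mle p0 _ Ap0) _.
      by rewrite sublinear0//; case: (svalP p0).
    have agt0 : 0 < a by rewrite lt_neqAle eq_sym a00.
    rewrite -ler_pdivrMl//; apply: lb_le_inf => // _ [u Pu <-].
    rewrite ler_pdivrMl//; apply: le_trans (mle u _ Pu) _.
    by have [[_ uZ] _] := svalP u; exact: uZ.
  exists (exist _ m mP) => p Ap; apply/asboolP => x /=; exact: mle.
exists L; split=> // p sp pL.
have pq x : p x <= q x by exact: le_trans (pL x) (Lq x).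
suff /(congr1 sval) : exist _ p (conj sp pq) =
  exist (fun p => sublinear p /\ forall x, p x <= q x) L (conj sL Lq) by [].
by apply: Lmin; apply/asboolP.
Qed.

(* Reducing along the ray through [z] yields a sublinear minorant of [L], equal
   to [L] by minimality, and its value at [x] is at most [L (x + z) - L z]. *)
Lemma minimal_sublinear_additive L : sublinear L ->
  (forall p, sublinear p -> (forall x, p x <= L x) -> p = L) ->
  forall x z, L x + L z <= L (x + z).
Proof.
move=> sL Lmin x z.
pose P : set (E * R) := [set u | exists2 t, 0 <= t & u = (t *: z, t * L z)].
have cP : convex_cone P.
  split.
  - by exists 0; rewrite ?scale0r ?mul0r.
  - move=> _ _ [t t0 ->] [s s0 ->]; exists (t + s); first exact: addr_ge0.
    by rewrite scalerDl mulrDl.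
  - move=> a _ a0 [t t0 ->]; exists (a * t); first exact: mulr_ge0.
    by rewrite /= scalerA mulrA.
have PL u : P u -> u.2 <= L u.1.
  move=> [t t0 ->] /=; have [->|t00] := eqVneq t 0.
    by rewrite scale0r mul0r sublinear0.
  have tgt0 : 0 < t by rewrite lt_neqAle eq_sym t00.
  rewrite -ler_pdivlMl//; have := sL.2 t^-1 (t *: z).
  by rewrite scalerA mulVf// scale1r invr_ge0; exact.
have le1 w : cone_reduction L P w <= L w.
  have [P0 _ _] := cP.
  by have := cone_reduction_le L P w _ sL PL P0; rewrite /= addr0 subr0.
have eqL := Lmin _ (sublinear_cone_reduction L P sL cP PL) le1.
have := cone_reduction_le L P x (z, L z) sL PL.
by rewrite eqL /= -lerBrDr => -> //; exists 1; rewrite ?scale1r ?mul1r.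
Qed.

(* Mazur-Orlicz form of the Hahn-Banach theorem. *)
Lemma hahn_banach_cone q P : sublinear q -> convex_cone P ->
  (forall u, P u -> u.2 <= q u.1) ->
  exists L : E -> R^o, [/\ linear L, (forall x, L x <= q x) &
    forall u, P u -> u.2 <= L u.1].
Proof.
move=> sq cP Pq; have sp := sublinear_cone_reduction _ _ sq cP Pq.
have [P0 _ _] := cP.
have [L [sL Lp Lmin]] := sublinear_minorant _ sp.
have LD x z : L (x + z) = L x + L z.
  apply/eqP; rewrite eq_le sL.1.
  by rewrite (minimal_sublinear_additive L).
have L0 : L 0 = 0 by exact: sublinear0.
have LN x : L (- x) = - L x.
  by have := LD x (- x); rewrite subrr L0; lra.
have LZp a x : 0 <= a -> L (a *: x) = a * L x.
  move=> a0; apply/eqP; rewrite eq_le sL.2//=.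
  by have := sL.2 a (- x) a0; rewrite scalerN !LN; lra.
have LZ a x : L (a *: x) = a * L x.
  have [a0|a0] := leP 0 a; first exact: LZp.
  by rewrite -[a]opprK scaleNr LN LZp ?oppr_ge0 ?ltW//; lra.
exists L; split.
- by move=> a x z; rewrite LD LZ.
- move=> x; apply: le_trans (Lp x) _.
  by have := cone_reduction_le q P x _ sq Pq P0; rewrite /= addr0 subr0.
- move=> u Pu; have := cone_reduction_le q P (- u.1) u sq Pq Pu.
  by have := Lp (- u.1); rewrite LN addNr sublinear0//; lra.
Qed.

End Sandwich.

(** * Clarke derivatives *)
Section ClarkeDerivative.
Context {R : realType} {X : normedModType R}.
Implicit Types (F : X -> R) (x v w : X) (r s : R).

(** The Clarke derivative is the infimum of these [r]. Working with the bounds themselves keeps the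
    arithmetic in the reals. *)
Definition increment_bound F x v r := exists2 d : R, 0 < d &
  forall z t, `|z - x| < d -> 0 < t -> t < d -> F (z + t *: v) - F z <= r * t.

Lemma increment_bound_le F x v r s : r <= s ->
  increment_bound F x v r -> increment_bound F x v s.
Proof.
move=> rs [d d0 H]; exists d => // z t zx t0 td.
by apply: le_trans (H z t zx t0 td) _; rewrite ler_pM2r.
Qed.

(** Move along [v], then along [w] from the point reached. This is legitimate because the base point
    is free near [x]; half of [e] is reserved for [z] and half for the shift [t *: v]. *)
Lemma increment_boundD F x v w r s :
  increment_bound F x v r -> increment_bound F x w s ->
  increment_bound F x (v + w) (r + s).
Proof.
move=> [d d0 H] [e e0 K].
pose m := Num.min d (e / 2 / (1 + `|v|)).
have v1 : 0 < 1 + `|v| by rewrite ltr_pwDl.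
have m0 : 0 < m by rewrite lt_min d0 !divr_gt0.
exists (Num.min m (e / 2)); first by rewrite lt_min m0 divr_gt0.
move=> z t; rewrite !lt_min => /andP[/andP[zd _] ze] t0 /andP[/andP[td te] _].
have h1 := H z t zd t0 td.
have h2 : F (z + t *: v + t *: w) - F (z + t *: v) <= s * t.
  apply: K => //.
    have -> : z + t *: v - x = (z - x) + t *: v by rewrite addrAC.
    apply: le_lt_trans (ler_normD _ _) _; rewrite normrZ gtr0_norm//.
    have : t * (1 + `|v|) < e / 2 by rewrite -ltr_pdivlMr.
    have : 0 <= `|v| by []. nra.
  have : t * (1 + `|v|) < e / 2 by rewrite -ltr_pdivlMr.
  have : 0 <= `|v| by []. nra.
by rewrite scalerDr addrA; lra.
Qed.

Lemma increment_boundZ F x v r a : 0 < a ->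
  increment_bound F x v r -> increment_bound F x (a *: v) (a * r).
Proof.
move=> a0 [d d0 H]; exists (Num.min d (d / a)).
  by rewrite lt_min d0 divr_gt0.
move=> z t; rewrite !lt_min => /andP[zd _] t0 /andP[_ td].
have := H z (t * a) zd (mulr_gt0 t0 a0).
rewrite -ltr_pdivlMr// => /(_ td); rewrite scalerA [a * r]mulrC -mulrA.
by rewrite [a * t]mulrC.
Qed.

Lemma increment_bound0 F x : increment_bound F x 0 0.
Proof.
by exists 1 => // z t _ _ _; rewrite scaler0 addr0 subrr mul0r.
Qed.

Lemma clarke_derivative_le F x v r :
  increment_bound F x v r -> (clarke_derivative F x v <= r%:E)%E.
Proof.
move=> [d d0 H]; apply: ge_ereal_inf.
exists (ereal_sup ((fun zt : X * R =>
    ((F (zt.1 + zt.2 *: v) - F zt.1) / zt.2)%:E) @`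
    [set zt | `|zt.1 - x| < d /\ 0 < zt.2 < d])).
  eexists; last reflexivity.
  exists (ball x d, [set t | 0 < t < d]) => /=.
    split; first exact: nbhsx_ballx.
    exists d => //= t; rewrite /ball_ /= sub0r normrN => td t0.
    by rewrite t0/= (le_lt_trans (ler_norm _) td).
  move=> [z t] /= [+ zt]; rewrite -ball_normE /ball_ /= distrC => zx.
  by split.
apply: ge_ereal_sup => _ [[z t] /= [zx /andP[t0 td]] <-].
by rewrite lee_fin ler_pdivrMr//; apply: H.
Qed.

Lemma clarke_derivative_lt F x v r : (clarke_derivative F x v < r%:E)%E ->
  exists2 s, s < r & increment_bound F x v s.
Proof.
move=> /ereal_inf_lt[_ [A FA <-]] supA.
have [s sr sA] : exists2 s, s < r & forall z t, A (z, t) ->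
    (F (z + t *: v) - F z) / t <= s.
  have ub z t : A (z, t) -> (((F (z + t *: v) - F z) / t)%:E <=
      ereal_sup ((fun zt : X * R =>
    ((F (zt.1 + zt.2 *: v) - F zt.1) / zt.2)%:E) @` A))%E.
    by move=> Azt; apply: ereal_sup_ubound; exists (z, t).
  move: ub supA; case: (ereal_sup _) => [s| |] ub; rewrite ?lte_fin => sr.
  - by exists s => // z t /ub; rewrite lee_fin.
  - by [].
  - by exists (r - 1); [lra|move=> z t /ub].
exists s => //; case: FA => -[B C] /= [/nbhs_ballP[d d0 dB]].
move=> [e /= e0 eC] BCA; exists (Num.min d e); first by rewrite lt_min d0.
move=> z t; rewrite !lt_min => /andP[zd _] t0 /andP[_ te].
rewrite -ler_pdivrMr//; apply: sA; apply: BCA; split => /=.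
  by apply: dB; rewrite -ball_normE /ball_ /= distrC.
by apply: eC => //=; rewrite sub0r normrN gtr0_norm.
Qed.

Definition clarke_real F x v : R := inf [set r | increment_bound F x v r].

Definition lipschitz_near F x (k : R) := exists2 d : R, 0 < d &
  forall z w, `|z - x| < d -> `|w - x| < d -> `|F z - F w| <= k * `|z - w|.

Lemma locally_lipschitzP F x : locally_lipschitz (F : X -> R^o) ->
  exists2 k, 0 <= k & lipschitz_near F x k.
Proof.
move=> /(_ x)[U /nbhs_ballP[d /= d0 dU] [k kF]]; exists (Num.max 0 k).
  by rewrite le_max lexx.
exists d => // z w zx wx.
have Uz : U z by apply: dU; rewrite -ball_normE /ball_ /= distrC.
have Uw : U w by apply: dU; rewrite -ball_normE /ball_ /= distrC.
apply: le_trans (kF (z, w) (conj Uz Uw)) _.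
by rewrite ler_wpM2r// le_max lexx orbT.
Qed.

Section LipschitzBound.
Variables (F : X -> R) (x : X) (k : R).
Hypothesis Fk : lipschitz_near F x k.

Lemma lipschitz_near_increment v : exists2 d : R, 0 < d &
  forall z t, `|z - x| < d -> 0 < t -> t < d ->
    `|F (z + t *: v) - F z| <= k * `|v| * t.
Proof.
have [d d0 H] := Fk; have v1 : 0 < 1 + `|v| by rewrite ltr_pwDl.
exists (Num.min (d / 2) (d / 2 / (1 + `|v|))).
  by rewrite lt_min !divr_gt0.
move=> z t; rewrite !lt_min => /andP[zd _] t0 /andP[td].
rewrite ltr_pdivlMr// => tv; have v0 : 0 <= `|v| by [].
have := H (z + t *: v) z.
have -> : z + t *: v - z = t *: v by rewrite addrAC subrr add0r.
rewrite normrZ gtr0_norm// mulrCA mulrC; apply; last by lra.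
have -> : z + t *: v - x = (z - x) + t *: v by rewrite addrAC.
by apply: le_lt_trans (ler_normD _ _) _; rewrite normrZ gtr0_norm//; nra.
Qed.

Lemma increment_bound_lipschitz v : increment_bound F x v (k * `|v|).
Proof.
have [d d0 H] := lipschitz_near_increment v; exists d => // z t zx t0 td.
by apply: le_trans (ler_norm _) _; exact: H.
Qed.

Lemma increment_bound_ge v r : increment_bound F x v r -> - (k * `|v|) <= r.
Proof.
move=> [e e0 K]; have [d d0 H] := lipschitz_near_increment v.
pose t := Num.min d e / 2.
have de0 : 0 < Num.min d e by rewrite lt_min d0.
have t0 : 0 < t by rewrite divr_gt0.
have tde : t < Num.min d e by rewrite /t; lra.
move: tde; rewrite lt_min => /andP[td te].
have xx (c : R) : 0 < c -> `|x - x| < c by rewrite subrr normr0.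
have := K x t (xx _ e0) t0 te; have := H x t (xx _ d0) t0 td.
rewrite ler_norml => /andP[h1 _] h2.
by rewrite -(ler_pM2r t0) mulNr; lra.
Qed.

Lemma clarke_real_ge v r : increment_bound F x v r -> clarke_real F x v <= r.
Proof.
move=> H; apply: ge_inf => //; exists (- (k * `|v|)) => s.
exact: increment_bound_ge.
Qed.

Lemma sublinear_clarke_real : sublinear (clarke_real F x).
Proof.
have ne v : [set r | increment_bound F x v r] !=set0.
  by exists (k * `|v|); exact: increment_bound_lipschitz.
split=> [v w|a v].
  apply/ler_addgt0Pr => e e0; have e2 : 0 < e / 2 by rewrite divr_gt0.
  have [r Hr rv] := inf_lt (ne v) (ltr_pwDr e2 (lexx _)).
  have [s Hs sw] := inf_lt (ne w) (ltr_pwDr e2 (lexx _)).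
  have := clarke_real_ge _ _ (increment_boundD _ _ _ _ _ _ Hr Hs).
  by move: rv sw; rewrite -!/(clarke_real _ _ _); lra.
rewrite le_eqVlt => /predU1P[<-|a0].
  rewrite scale0r mul0r; exact/clarke_real_ge/increment_bound0.
rewrite -ler_pdivrMl//; apply: lb_le_inf => // r Hr.
rewrite ler_pdivrMl//; exact/clarke_real_ge/increment_boundZ.
Qed.

Lemma le_clarke_derivative v r : r <= clarke_real F x v ->
  (r%:E <= clarke_derivative F x v)%E.
Proof.
move=> rv; rewrite leNgt; apply/negP => /clarke_derivative_lt[s sr].
by move=> /clarke_real_ge; lra.
Qed.

End LipschitzBound.

Lemma linear_bounded_blin (L : X -> R^o) (k : R) : linear L ->
  (forall v, L v <= k * `|v|) -> 0 <= k ->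
  exists2 xs : blin X R^o, (xs : X -> R^o) = L & `|xs| <= k.
Proof.
move=> linL Lk k0; have LN v : L (- v) = - L v.
  have := linL (-1) v 0; have := linL (-1) 0 0.
  by rewrite !scaler0 !addr0 scaleN1r => ->; rewrite !scaleN1r addNr addr0.
have LB v : `|L v| <= k * `|v|.
  by rewrite ler_norml Lk andbT lerNl -LN -(normrN v) Lk.
have bL : L \in @bounded_operator_pred R X R^o.
  by apply/bounded_operatorP; split=> //; exists k.
by exists (BLin bL) => //; exact: opnorm_le.
Qed.

(** The assumption says that the sublinear Clarke derivative dominates the concave function
    [- m * |v|]. Hahn-Banach puts a linear functional in between: the upper bound makes it a
    subgradient, the lower one gives it norm at most [m]. *)
Lemma clarke_subdifferential_of_bound F x (k m : R) : 0 <= k -> 0 <= m ->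
  lipschitz_near F x k ->
  (forall v r, increment_bound F x v r -> - (m * `|v|) <= r) ->
  exists2 xs, clarke_subdifferential F x xs & `|xs| <= m.
Proof.
move=> k0 m0 Fk Fm; have sq := sublinear_clarke_real F x k Fk.
have [|u Pu|L [linL Lq LP]] := hahn_banach_cone (clarke_real F x)
    [set u : X * R | u.2 <= - (m * `|u.1|)] sq.
- split=> /=; first by rewrite normr0 mulr0 oppr0.
    move=> [v r] [w s] /= vr ws; have := ler_normD v w.
    by move/(ler_wpM2l m0); lra.
  move=> a [v r] /= a0 vr; rewrite normrZ (ger0_norm a0).
  by have := ler_wpM2l a0 vr; lra.
- apply: le_trans Pu _; apply: lb_le_inf => [|r]; last exact: Fm.
  by exists (k * `|u.1|); exact: increment_bound_lipschitz.
have Lm v : L v <= m * `|v|.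
  have := LP (- v, - (m * `|v|)); rewrite /= normrN => /(_ (lexx _)).
  have := linL (-1) v 0; have := linL (-1) 0 0.
  rewrite !scaler0 !addr0 scaleN1r => ->; rewrite !scaleN1r addNr addr0 => ->.
  by rewrite lerN2.
have [xs xsL xsm] := linear_bounded_blin L m linL Lm m0.
exists xs => // v; rewrite xsL; apply: le_clarke_derivative => //.
exact: Fk.
Qed.

Lemma clarke_subdifferential_neq0 F x : locally_lipschitz (F : X -> R^o) ->
  clarke_subdifferential F x !=set0.
Proof.
move=> /(locally_lipschitzP F x)[k k0 Fk].
have [v r|xs] := clarke_subdifferential_of_bound F x k k k0 k0 Fk.
  exact: increment_bound_ge.
by exists xs.
Qed.

Lemma clarke_slope_le F x xs : clarke_subdifferential F x xs ->
  clarke_slope F x <= `|xs|.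
Proof.
move=> Fxs; apply: ge_inf; last by exists xs.
by exists 0 => _ [? _ <-].
Qed.

Lemma clarke_slope_ge F x (m : R) : locally_lipschitz (F : X -> R^o) ->
  (forall xs, clarke_subdifferential F x xs -> m <= `|xs|) ->
  m <= clarke_slope F x.
Proof.
move=> FL Fm; apply: lb_le_inf; last by move=> _ [xs Fxs <-]; exact: Fm.
by have [xs Fxs] := clarke_subdifferential_neq0 F x FL; exists `|xs|, xs.
Qed.

(** If no [v] descended at a rate above [m * |v|], there would be a subgradient of norm at most [m],
    contradicting the slope. Normalising such a [v] gives the direction. *)
Lemma clarke_descent F x (m : R) : locally_lipschitz (F : X -> R^o) ->
  0 <= m -> m < clarke_slope F x ->
  exists v, `|v| <= 1 /\ increment_bound F x v (- m).
Proof.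
move=> FL m0 mF; have [k k0 Fk] := locally_lipschitzP F x FL.
have [[v [r [Hr rm]]]|H] :=
    pselect (exists v r, increment_bound F x v r /\ r < - (m * `|v|)); last first.
  have [v r Hr|xs Fxs] := clarke_subdifferential_of_bound F x k m k0 m0 Fk.
    by rewrite leNgt; apply/negP => rm; apply: H; exists v, r.
  by have := clarke_slope_le F x xs Fxs; lra.
have v0 : 0 < `|v|.
  rewrite normr_gt0; apply/eqP => v0; move: Hr rm; rewrite v0 normr0 mulr0 oppr0.
  by move=> /(increment_bound_ge F x k Fk); rewrite normr0 mulr0 oppr0; lra.
exists (`|v|^-1 *: v); split.
  by rewrite normrZ normfV normr_id mulVf// gt_eqF.
have vi : 0 < `|v|^-1 by rewrite invr_gt0.
apply: increment_bound_le (increment_boundZ _ _ _ _ _ vi Hr).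
by rewrite ler_pdivrMl//; lra.
Qed.

End ClarkeDerivative.

(** * Regular pseudo-Jacobians *)
Section Regularity.
Context {R : realType}.

Lemma blin_comp_le {X Y Z : normedModType R} (S : blin Y Z) (T : blin X Y) :
  `|blin_comp S T| <= `|S| * `|T|.
Proof.
apply: opnorm_le => [|x]; first by rewrite mulr_ge0.
apply: le_trans (opnormP S _) _; rewrite -mulrA.
by rewrite ler_wpM2l ?opnormP ?opnorm_ge0.
Qed.

Lemma norming_functional {X : normedModType R} (u : X) :
  exists2 xs : blin X R^o, `|xs| <= 1 & xs u = `|u|.
Proof.
have sq : sublinear (fun x : X => `|x|).
  split=> [x y|a x a0]; first exact: ler_normD.
  by rewrite normrZ ger0_norm.
have [|w [t t0 ->]|L [linL Lq LP]] := hahn_banach_cone (fun x : X => `|x|)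
    [set w : X * R | exists2 t, 0 <= t & w = (t *: u, t * `|u|)] sq.
- split.
  + by exists 0; rewrite ?scale0r ?mul0r.
  + move=> _ _ [t t0 ->] [s s0 ->]; exists (t + s); first exact: addr_ge0.
    by rewrite scalerDl mulrDl.
  + move=> a _ a0 [t t0 ->]; exists (a * t); first exact: mulr_ge0.
    by rewrite /= scalerA mulrA.
- by rewrite /= normrZ ger0_norm.
have L1 v : L v <= 1 * `|v| by rewrite mul1r.
have [xs xsL xs1] := linear_bounded_blin L 1 linL L1 ler01.
exists xs => //; rewrite xsL; apply/eqP; rewrite eq_le Lq/=.
apply: (LP (u, `|u|)); exists 1 => //; by rewrite scale1r mul1r.
Qed.

Lemma norm_subgradient_ge1 {Y : normedModType R} (w : Y) (ys : blin Y R^o) :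
  w != 0 -> clarke_subdifferential (fun z : Y => `|z|) w ys -> 1 <= `|ys|.
Proof.
move=> w0 ysw; have nw : 0 < `|w| by rewrite normr_gt0.
suff H : `|w| <= `|ys w|.
  have := le_trans H (opnormP ys w).
  by rewrite -[X in X <= _]mul1r ler_pM2r.
suff : ys (- w) <= - `|w|.
  by rewrite linearN lerN2 => h; apply: le_trans h (ler_norm _).
apply/ler_addgt0Pr => e e0.
have Hb : increment_bound (fun z : Y => `|z|) w (- w) (- `|w| + e).
  exists (Num.min 1 (e / 2)); first by rewrite lt_min ltr01 divr_gt0.
  move=> z t; rewrite !lt_min => /andP[_ ze] t0 /andP[t1 _].
  (* Convexity bounds the increment by [- t * |z| + t * |z - w|], hence by
     [- t * |w| + 2 * t * |z - w|]; this explains the radius [e / 2]. *)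
  have -> : z + t *: - w = (1 - t) *: z + t *: (z - w).
    by rewrite scalerBl scale1r scalerBr scalerN addrA subrK.
  have := ler_normD ((1 - t) *: z) (t *: (z - w)).
  rewrite !normrZ (gtr0_norm t0) ger0_norm; last by lra.
  have : `|w| <= `|z| + `|z - w|.
    by rewrite -[X in `|X| <= _](subKr z) ler_normB.
  nra.
have := le_trans (ysw (- w)) (clarke_derivative_le _ _ _ _ Hb).
by rewrite lee_fin.
Qed.

Context {X Y : normedModType R}.
Implicit Types (T : blin X Y) (J : X -> set (blin X Y)).

Lemma surj_modulusP T (c : R) : (c%:E <= surj_modulus T)%E ->
  forall ys : blin Y R^o, c * `|ys| <= `|blin_comp ys T|.
Proof.
move=> cT ys; have [->|ys0] := eqVneq ys 0; first by rewrite normr0 mulr0.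
have n0 : 0 < `|ys| by rewrite normr_gt0.
have : (c%:E <= `|blin_comp (`|ys|^-1 *: ys) T|%:E)%E.
  apply: le_trans cT _; apply: ereal_inf_lbound; exists (`|ys|^-1 *: ys) => //=.
  by rewrite normrZ normfV normr_id mulVf// gt_eqF.
have -> : blin_comp (`|ys|^-1 *: ys) T = `|ys|^-1 *: blin_comp ys T.
  exact: blin_ext.
by rewrite lee_fin normrZ normfV normr_id mulrC ler_pdivlMr.
Qed.

Lemma surj_modulus_closure (A : set (blin X Y)) T (c : R) :
  (forall S, A S -> (c%:E <= surj_modulus S)%E) -> closure A T ->
  forall ys : blin Y R^o, c * `|ys| <= `|blin_comp ys T|.
Proof.
move=> cA clT ys; apply/ler_addgt0Pr => e e0.
(* Composition with [ys] is [|ys|]-Lipschitz in operator norm; the added 1 only prevents a division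
   by zero. *)
have y1 : 0 < 1 + `|ys| by rewrite ltr_pwDl.
have [S [AS TS]] := clT _ (nbhsx_ballx T (e / (1 + `|ys|)) (divr_gt0 e0 y1)).
have := surj_modulusP S c (cA S AS) ys.
have -> : blin_comp ys S = blin_comp ys T - blin_comp ys (T - S).
  apply: blin_ext => x; change (ys (S x) = ys (T x) - ys (T x - S x)).
  by rewrite linearB subKr.
move=> h; have := ler_normB (blin_comp ys T) (blin_comp ys (T - S)).
have := blin_comp_le ys (T - S).
move: TS; rewrite -ball_normE /ball_ /= ltr_pdivlMr//.
have : 0 <= `|T - S| by [].
nra.
Qed.

(** Let [xs] norm [u] and pull it back to [xs o S], with [S] the inverse of [T]. The surjectivity
    bound gives [c * |xs o S| <= |xs| <= 1], while [xs o S] takes the value [|u|] at [T u]. *)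
Lemma isomorphism_expanding T (c : R) : 0 < c -> isomorphism T ->
  (c%:E <= surj_modulus T)%E -> forall u, c * `|u| <= `|T u|.
Proof.
move=> c0 [S [TS ST]] cT u; have [xs xs1 xsu] := norming_functional u.
have := surj_modulusP T c cT (blin_comp xs S).
have -> : blin_comp (blin_comp xs S) T = xs.
  by apply: blin_ext => x /=; rewrite TS.
move=> h; have := opnormP (blin_comp xs S) (T u); rewrite /= TS xsu normr_id.
have : 0 <= `|T u| by [].
rewrite -/(`|blin_comp xs S|) => h0 h1.
apply: (@le_trans _ _ ((c * `|blin_comp xs S|) * `|T u|)).
  by rewrite -mulrA ler_wpM2l// ltW.
by rewrite -[leRHS]mul1r ler_wpM2r// (le_trans h).
Qed.

Lemma convex_hull_mono {E : lmodType R} (A B : set E) :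
  A `<=` B -> convex_hull A `<=` convex_hull B.
Proof.
by move=> AB x Ax C [cC BC]; apply: Ax; split => //; exact: subset_trans BC.
Qed.

Lemma hull_near_sub J x (r s : R) : r <= s -> hull_near J x r `<=` hull_near J x s.
Proof.
move=> rs; apply: convex_hull_mono => T [z zr JT]; exists z => //.
by apply: (le_ball rs).
Qed.

Lemma regular_atP J x : regular_at J x -> exists r c : R, [/\ 0 < r, 0 < c &
  forall T, hull_near J x r T -> isomorphism T /\ (c%:E <= surj_modulus T)%E].
Proof.
move=> [[r r0 iso] /ereal_sup_gt[_ [s /= s0 <-] infpos]].
have [c c0 cinf] : exists2 c : R, 0 < c &
    (c%:E <= ereal_inf [set surj_modulus T | T in hull_near J x s])%E.
  move: infpos; case: (ereal_inf _) => [c| |] //=; first by exists c.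
  (* The infimum may be [+oo], for instance when [Y] is trivial and its dual unit sphere is empty;
     any positive constant then serves. *)
  by exists 1 => //; rewrite leey.
exists (Num.min r s), c; split => //; first by rewrite lt_min r0.
move=> T JT; split.
  by apply: iso; apply: hull_near_sub JT; rewrite ge_min lexx.
apply: le_trans cinf _; apply: ereal_inf_lbound; exists T => //.
by apply: hull_near_sub JT; rewrite ge_min lexx orbT.
Qed.

Lemma dist_to_locally_lipschitz (f : X -> Y) (y : Y) :
  locally_lipschitz f -> locally_lipschitz (dist_to f y : X -> R^o).
Proof.
move=> fL x; have [U xU [k kf]] := fL x; exists U => //; exists k => zw Uzw.
apply: le_trans (kf zw Uzw); apply: le_trans (ler_dist_dist _ _) _.
by rewrite opprB addrA subrK.
Qed.

Lemma clarke_slope_regular (f : X -> Y) J (y : Y) x :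
  strong_chain_rule f J -> regular_at J x -> exists r c : R,
    [/\ 0 < r, 0 < c & forall z, ball x r z -> f z <> y ->
      c <= clarke_slope (dist_to f y) z].
Proof.
move=> [fL chain] /regular_atP[r [c [r0 c0 H]]]; exists r, c; split => // z zr fzy.
apply: clarke_slope_ge => [|xs]; first exact: dist_to_locally_lipschitz.
have [_ _ _ sub] := chain z y (nesym fzy).
move=> /sub[ys ysn [T clT <-]].
have [S HS] : exists2 A, closure A T & forall S, A S -> (c%:E <= surj_modulus S)%E.
  exists (convex_hull (J z)) => // S JS; apply: (H S _).2.
  by apply: convex_hull_mono JS => S' JS'; exists z.
move=> /surj_modulus_closure/(_ HS ys).
have : 1 <= `|ys| by apply: norm_subgradient_ge1 ysn; rewrite subr_eq0; exact/eqP.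
by move=> y1 h; apply: le_trans h; rewrite -[leLHS]mulr1 ler_pM2l.
Qed.

End Regularity.

(** * Mean value inequality for pseudo-Jacobians *)

Section Expansion.
Context {R : realType}.

Lemma convex_hull_conv {E : lmodType R} (A : set E) (u v : E) (a b : R) :
  0 <= a -> 0 <= b -> a + b = 1 ->
  convex_hull A u -> convex_hull A v -> convex_hull A (a *: u + b *: v).
Proof.
move=> a0 b0 ab Au Av C [cC AC].
have a1 : a <= 1 by lra.
have := cC u v (Itv01 a0 a1); rewrite !inE => /(_ (Au C (conj cC AC)) (Av C (conj cC AC))).
by rewrite /conv /= /unstable.onem; have -> : 1 - a = b by lra.
Qed.

Lemma upper_dini_lt {X : normedModType R} (phi : X -> R) x v (r : R) :
  (upper_dini phi x v < r%:E)%E -> exists2 d : R, 0 < d &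
    forall t, 0 < t -> t < d -> phi (x + t *: v) - phi x <= r * t.
Proof.
move=> /ereal_inf_lt[_ [A [d /= d0 dA] <-]] supA; exists d => // t t0 td.
rewrite -ler_pdivrMr// -lee_fin; apply: le_trans (ltW supA).
apply: ereal_sup_ubound; exists t => //; apply: dA => //=.
by rewrite sub0r normrN gtr0_norm.
Qed.

(** Continuous induction: the last [t] in [[0, 1]] with [phi t - phi 0 <= (M + e) * t] exists by
    continuity, and the one-sided bound would push it further if it were below 1. *)
Lemma dini_mean_value (phi : R -> R) (M : R) : continuous phi ->
  (forall t e, 0 <= t -> t < 1 -> 0 < e -> exists2 d : R, 0 < d &
    forall s, 0 < s -> s < d -> phi (t + s) - phi t <= (M + e) * s) ->
  phi 1 - phi 0 <= M.
Proof.
move=> phic H; apply/ler_addgt0Pr => e e0.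
pose psi (t : R) := phi t - phi 0 - (M + e) * t.
have psic : continuous psi.
  move=> t; apply: cvgB; last by apply: cvgM; [exact: cvg_cst|exact: cvg_id].
  by apply: cvgB; [exact: phic|exact: cvg_cst].
pose A := [set t : R | [/\ 0 <= t, t <= 1 & psi t <= 0]].
have A0 : A 0 by split => //; rewrite /psi subrr mulr0 subr0.
have supA : has_sup A by split; [exists 0|exists 1 => t []].
pose t0 := sup A.
have t00 : 0 <= t0 by apply: ub_le_sup => //; exact: supA.2.
have t01 : t0 <= 1 by apply: ge_sup; [exists 0|move=> t []].
have psit0 : psi t0 <= 0.
  rewrite leNgt; apply/negP => psi0.
  have /nbhs_ballP[d /= d0 dpsi] : \forall t \near t0, 0 < psi t.
    by have /cvgr_gt := psic t0; exact.
  have [t At td] := sup_adherent d0 supA.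
  have [_ _ pt] := At.
  have tt0 : t <= t0 by apply: ub_le_sup => //; exact: supA.2.
  have : ball t0 d t.
    by rewrite -ball_normE /ball_ /= ger0_norm ?subr_ge0//; move: td; rewrite -/t0; lra.
  by move=> /dpsi; lra.
have [t1|t1] := eqVneq t0 1.
  by move: psit0; rewrite t1 /psi mulr1; lra.
have t0lt1 : t0 < 1 by rewrite lt_neqAle t1.
have [d d0 Hd] := H t0 e t00 t0lt1 e0.
pose s := Num.min d (1 - t0) / 2.
have dm : 0 < Num.min d (1 - t0) by rewrite lt_min d0 subr_gt0.
have s0 : 0 < s by rewrite divr_gt0.
have : s < Num.min d (1 - t0) by rewrite /s; lra.
rewrite lt_min => /andP[sd s1].
have : A (t0 + s).
  split; [lra|lra|]; have := Hd s s0 sd; move: psit0; rewrite /psi; lra.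
by move=> /(ub_le_sup supA.2); rewrite -/t0; lra.
Qed.

Context {X Y : normedModType R}.

(** Since [|T v| >= m] on a convex set of operators, a single [ys] of norm at most 1 satisfies
    [ys (T v) <= - m] for all of them. The negative sign suits the upper Dini derivative, which only
    yields upper bounds, and the mean value inequality along the segment gives
    [ys (f b - f a) <= - m]. *)
Lemma pseudo_jacobian_expanding (f : X -> Y) (J : X -> set (blin X Y)) x (r c : R) :
  continuous f -> pseudo_jacobian_map f J -> 0 <= c ->
  (forall T, hull_near J x r T -> forall u, c * `|u| <= `|T u|) ->
  forall a b, ball x r a -> ball x r b -> c * `|b - a| <= `|f b - f a|.
Proof.
move=> fc fJ c0 Jc a b xa xb; rewrite leNgt; apply/negP => fab.
pose v := b - a; pose m := c * `|v|.
have m0 : 0 <= m by rewrite mulr_ge0.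
pose H := hull_near J x r.
have Jhull z T : ball x r z -> J z T -> H T.
  by move=> xz JT; apply: sub_gen_smallest; exists z.
have sq : sublinear (fun w : Y => `|w|).
  split=> [w z|t w t0]; first exact: ler_normD.
  by rewrite normrZ ger0_norm.
have [|w [t [T [t0 HT ->]]]|L [linL Lq LP]] := hahn_banach_cone (fun w : Y => `|w|)
    [set w : Y * R | exists t T, [/\ 0 <= t, H T & w = (- (t *: T v), t * m)]] sq.
- split.
  + have [[T JT] _] := fJ a; exists 0, T; split => //; first exact: Jhull JT.
    by rewrite scale0r mul0r oppr0.
  + move=> _ _ [t [T [t0 HT ->]]] [s [S [s0 HS ->]]].
    (* The sum of two demands is the demand of the operator with convex weights [t / (t + s)] and
       [s / (t + s)], which requires [t + s] to be nonzero. *)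
    have [ts|ts] := eqVneq (t + s) 0.
      have -> : t = 0 by lra.
      have -> : s = 0 by lra.
      exists 0, T; split => //.
      by congr (_, _); rewrite /= ?scale0r ?mul0r ?oppr0 addr0.
    have tsp : 0 < t + s by rewrite lt_neqAle eq_sym ts addr_ge0.
    exists (t + s), ((t / (t + s)) *: T + (s / (t + s)) *: S); split.
    * exact: ltW.
    * apply: convex_hull_conv => //; first by rewrite divr_ge0// ltW.
        by rewrite divr_ge0// ltW.
      by rewrite -mulrDl divff.
    * congr (_, _); last by rewrite /= mulrDl.
      change (- (t *: T v) + - (s *: S v) = - ((t + s) *: ((t / (t + s)) *: T v + (s / (t + s)) *: S v))).
      by rewrite scalerDr !scalerA !(mulrC (t + s)) !divfK// opprD.
  + move=> k _ k0 [t [T [t0 HT ->]]]; exists (k * t), T; split => //.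
      exact: mulr_ge0.
    by rewrite /= scalerN scalerA mulrA.
- rewrite /= normrN normrZ ger0_norm//; apply: ler_wpM2l => //; exact: Jc.
have L1 w : L w <= 1 * `|w| by rewrite mul1r.
have [ys ysL ys1] := linear_bounded_blin L 1 linL L1 ler01.
have ysH T : H T -> ys (T v) <= - m.
  move=> HT; have := LP (- (T v), m); rewrite /= -ysL linearN => h.
  by rewrite lerNr; apply: h; exists 1, T; rewrite scale1r mul1r.
have ysc : continuous ys.
  move=> w; apply/cvgrPdist_le => e e0; apply/nbhs_ballP; exists e => //= z.
  rewrite -ball_normE /ball_ /= => wz; rewrite -linearB.
  apply: le_trans (opnormP ys _) _; apply: le_trans (ltW wz).
  by rewrite -[leRHS]mul1r ler_wpM2r.
suff : ys (f b) - ys (f a) <= - m.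
  have : `|ys (f b - f a)| <= `|f b - f a|.
    by apply: le_trans (opnormP ys _) _; rewrite -[leRHS]mul1r ler_wpM2r.
  by rewrite linearB ler_norml => /andP[+ _]; move: fab; rewrite -/v -/m; lra.
have av1 : b = a + (1 : R) *: v by rewrite scale1r addrC subrK.
have av0 : a = a + (0 : R) *: v by rewrite scale0r addr0.
rewrite {1}av1 [in X in _ - X]av0.
apply: (dini_mean_value (fun t => ys (f (a + t *: v)))) => [t|t e t0 t1 e0].
  apply: continuous_comp; last exact: ysc.
  apply: continuous_comp; last exact: fc.
  apply: cvgD; first exact: cvg_cst.
  by apply: cvgZr_tmp; exact: cvg_id.
have xt : ball x r (a + t *: v).
  move: xa xb; rewrite -!ball_normE /ball_ /= => xa xb.
  have -> : x - (a + t *: v) = (1 - t) *: (x - a) + t *: (x - b).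
    have -> : a + t *: v = (1 - t) *: a + t *: b.
      by rewrite scalerBr scalerBl scale1r -addrA [- _ + _]addrC.
    have {1}-> : x = (1 - t) *: x + t *: x by rewrite -scalerDl subrK scale1r.
    by rewrite opprD addrACA -!scalerBr.
  apply: le_lt_trans (ler_normD _ _) _.
  rewrite !normrZ (ger0_norm t0) ger0_norm; last by lra.
  by nra.
have [_ /(_ ys v) ud] := fJ (a + t *: v).
have [|d d0 K] := upper_dini_lt (ys \o f : X -> R) (a + t *: v) v (- m + e).
  apply: le_lt_trans ud _; apply: le_lt_trans (_ : _ <= (- m)%:E)%E _.
    by apply: ge_ereal_sup => _ [T JT <-]; rewrite lee_fin; exact: (ysH _ (Jhull _ _ xt JT)).
  by rewrite lte_fin; lra.
by exists d => // s s0 sd; have := K s s0 sd; rewrite /= -addrA -scalerDl.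
Qed.

End Expansion.

(** * The potential of a weight *)
Section WeightPotential.
Context {R : realType}.

(** [G r] is the integral of [1 / (1 + h)] over [[0, r]]. Monotonicity of [h] bounds the integrand
    on []r, s]] by its value at [r]; divergence of the full integral makes [G] unbounded. *)
Lemma weight_potential (h : R -> R) : weight h -> exists G : R -> R,
  [/\ (forall r s, 0 <= r -> r <= s -> G r <= G s),
      (forall r s, 0 <= r -> r <= s -> G s - G r <= (s - r) / (1 + h r)) &
      forall M, exists2 r, 0 <= r & M < G r].
Proof.
move=> [_ hmono h0 hinf].
pose g (a : R) : \bar R := ((1 + h a)^-1)%:E.
have hP a : 0 <= a -> 0 < 1 + h a by move=> /h0; lra.
have g0 a : 0 <= a -> (0 <= g a)%E.
  by move=> a0; rewrite lee_fin invr_ge0 ltW// hP.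
have mg (D : set R) : measurable D -> D `<=` `[0, +oo[ -> measurable_fun D g.
  move=> mD D0; apply/measurable_EFinP.
  (* Precomposing with [max 0] gives a function that is monotone on the whole line, hence
     measurable, and unchanged on [D]. *)
  apply: (eq_measurable_fun (fun a : R => (1 + h (Num.max 0 a))^-1)).
    move=> a; rewrite inE => /D0; rewrite /= in_itv /= andbT => a0.
    by rewrite max_r.
  apply: nonincreasing_measurable => // a b ab.
  have max0 c : 0 <= Num.max 0 c :> R by rewrite le_max lexx.
  rewrite lef_pV2 ?posrE ?hP// lerD2l.
  by apply: hmono; rewrite ?in_itv /= ?max0// ge_max !le_max lexx ab orbT.
have itv0 (a b : itv_bound R) : (BLeft 0 <= a)%O ->
    [set` Interval a b] `<=` `[0, +oo[%classic.
  by move=> a0; apply: subset_itv => //; case: b => [[]|[]].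
pose I r := (\int[lebesgue_measure]_(a in `[0%R, r]) g a)%E.
have gitv r s : 0 <= r -> r <= s ->
    (\int[lebesgue_measure]_(a in `]r, s]) g a <= ((s - r) / (1 + h r))%:E)%E.
  move=> r0 rs; apply: (@le_trans _ _
    (\int[lebesgue_measure]_(a in `]r, s]) cst ((1 + h r)^-1)%:E a)%E).
    apply: ge0_le_integral => //.
    - by move=> a; rewrite /= in_itv /= => /andP[ra _]; apply: g0; exact: le_trans r0 (ltW ra).
    - apply: mg => //; exact: itv0.
    - move=> a; rewrite /= in_itv /= => /andP[ra _].
      have a0 : 0 <= a := le_trans r0 (ltW ra).
      rewrite lee_fin lef_pV2 ?posrE ?hP// lerD2l.
      by apply: hmono; rewrite ?in_itv /= ?r0 ?a0// ltW.
  rewrite integral_cst//= lebesgue_measure_itv/= lte_fin.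
  case: ifPn => _; first by rewrite -EFinB -EFinM mulrC.
  by rewrite mule0 lee_fin divr_ge0 ?subr_ge0// ltW// hP.
have Isplit r s : 0 <= r -> r <= s ->
    I s = (I r + \int[lebesgue_measure]_(a in `]r, s]) g a)%E.
  move=> r0 rs; rewrite /I (@itv_bndbnd_setU _ _ _ (BRight r)) ?bnd_simp//.
  rewrite ge0_integral_setU//.
  - apply: mg; first exact: measurableU.
    by rewrite subUset; split; exact: itv0.
  - move=> a [] /=; rewrite in_itv /= => /andP[ra _]; apply: g0 => //.
    exact: le_trans r0 (ltW ra).
  - apply/disj_setPS => a [] /=; rewrite !in_itv /= => /andP[_ h1] /andP[h2 _].
    by move: (lt_le_trans h2 h1); rewrite ltxx.
have I0 r : 0 <= r -> I r \is a fin_num.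
  move=> r0; rewrite ge0_fin_numE; last first.
    by apply: integral_ge0 => a; rewrite /= in_itv /= => /andP[/g0].
  rewrite (Isplit 0 r)// /I set_itv1 integral_set1 add0e.
  exact: le_lt_trans (gitv 0 r (lexx _) r0) (ltry _).
have J0 r s : 0 <= r -> (0 <= \int[lebesgue_measure]_(a in `]r, s]) g a)%E.
  move=> r0; apply: integral_ge0 => a; rewrite /= in_itv /= => /andP[ra _].
  by apply: g0; exact: le_trans r0 (ltW ra).
exists (fun r => fine (I r)); split.
- move=> r s r0 rs; rewrite fine_le ?I0//; first exact: le_trans rs.
  by rewrite (Isplit r s)// leeDl// J0.
- move=> r s r0 rs; rewrite lerBlDl -lee_fin EFinD !fineK ?I0//; last first.
    exact: le_trans rs.
  by rewrite (Isplit r s)// leeD2l// gitv.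
- move=> M; have /cvgey_gt/(_ M)[n _ /(_ n (leqnn n)) nM] :
    I (n%:R : R) @[n --> \oo] --> +oo%E.
    rewrite -hinf (_ : `[0, +oo[%classic = \bigcup_n `[0, n%:R : R]%classic).
      2: by rewrite itv_bndy_bigcup_BRight; under eq_bigcupr do rewrite add0r.
    apply: ge0_nondecreasing_set_cvg_integral => //.
    + move=> n m nm; rewrite subsetEset; apply: subset_itvl.
      by rewrite bnd_simp ler_nat.
    + by move=> n; apply: mg => //; exact: itv0.
    + by move=> n a /=; rewrite in_itv /= => /andP[/g0].
  exists n%:R => //; rewrite -lte_fin fineK ?I0//.
Qed.

End WeightPotential.

(** * Minimax levels *)
Section BrezisBrowder.
Context {R : realType}.

(** Choose each term below the previous one with [phi] almost equal to its infimum there. If [b]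
    lies below a lower bound [a] of the sequence, then [phi b] is at least each of these infima,
    which leaves no room for [phi b < phi a]. *)
Lemma brezis_browder {T : Type} (le : T -> T -> Prop) (phi : T -> R) (m : R) :
  (forall a, le a a) -> (forall b a c, le a b -> le b c -> le a c) ->
  (forall a, m <= phi a) -> (forall a b, le a b -> phi a <= phi b) ->
  (forall u : nat -> T, (forall n, le (u n.+1) (u n)) ->
    exists a, forall n, le a (u n)) ->
  forall a0, exists2 a, le a a0 & forall b, le b a -> phi b = phi a.
Proof.
move=> lexx letr phim phile lelim a0.
pose low a := inf [set phi b | b in [set b | le b a]].
have low_le a b : le b a -> low a <= phi b.
  by move=> ba; apply: ge_inf; [exists m => _ [? _ <-]|exists b].
(* The second component counts the steps, so that the tolerance can shrink along the dependent
   choice. *)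
have step (p : T * nat) : {q : T * nat | le q.1 p.1 /\ q.2 = p.2.+1 /\
    phi q.1 < low p.1 + p.2.+1%:R^-1}.
  apply: cid; case: p => a n /=.
  have [||_ [b ba <-] bl] := @inf_lt _ [set phi b | b in [set b | le b a]]
      (low a + n.+1%:R^-1).
  - by exists (phi a), a.
  - by rewrite ltrDl invr_gt0.
  by exists (b, n.+1).
have [u [u0 uS]] := dependent_choice step (a0, 0%N).
have un n : (u n).2 = n.
  by elim: n => [|n IH]; [rewrite u0|rewrite (uS n).2.1 IH].
have [a ale] := lelim (fun n => (u n).1) (fun n => (uS n).1).
exists a; first by have := ale 0%N; rewrite u0.
move=> b ba; apply/eqP; rewrite eq_le phile//=.
apply/ler_addgt0Pr => e e0.
have [n ne] : exists n, n.+1%:R^-1 < e.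
  have := near_infty_natSinv_lt (PosNum e0) => -[n _ /(_ n (leqnn n))].
  by exists n.
have h1 := phile _ _ (ale n.+1).
have h2 := low_le _ _ (letr _ _ _ ba (ale n)).
move: h1 h2 => /= h1 h2; have [_ [_ h3]] := uS n; rewrite un in h3.
by move: h1 h2 h3 ne; move: (n.+1%:R^-1) => d; lra.
Qed.

End BrezisBrowder.

(** * Deformation along descent directions *)

Section Deformation.
Context {R : realType} {X : normedModType R}.
Implicit Types (F : X -> R) (l : seq X).

(** Directions of norm at most 1 with total weight at most [m] keep every partial sum within [m] of
    [z], so the descent estimate is available at each intermediate point. It is requested only where
    [a x != 0], that is, where a cut-off is active. *)
Lemma descent_sum F l (a : X -> R) (v : X -> X) (z : X) (k m : R) :
  (forall x, x \in l -> 0 <= a x) -> (forall x, x \in l -> `|v x| <= 1) ->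
  (forall x w t, x \in l -> a x != 0 -> `|w - z| <= m -> 0 < t -> t <= m ->
    F (w + t *: v x) - F w <= - k * t) ->
  \sum_(x <- l) a x <= m ->
  F (z + \sum_(x <- l) a x *: v x) <= F z - k * \sum_(x <- l) a x /\
  `|\sum_(x <- l) a x *: v x| <= \sum_(x <- l) a x.
Proof.
elim: l => [|x l IH] a0 v1 H.
  by rewrite !big_nil addr0 mulr0 subr0 normr0.
rewrite !big_cons => alm.
have xl : x \in x :: l by rewrite mem_head.
have sub y : y \in l -> y \in x :: l by rewrite in_cons => ->; rewrite orbT.
have sum0 : 0 <= \sum_(y <- l) a y.
  by rewrite big_seq; apply: sumr_ge0 => y /sub/a0.
have ax0 := a0 x xl.
have [||||IHF IHn] := IH.
- by move=> y /sub/a0.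
- by move=> y /sub/v1.
- by move=> y w t /sub; exact: H.
- by lra.
have vx1 := v1 x xl.
split; last first.
  apply: le_trans (ler_normD _ _) _; apply: lerD => //.
  by rewrite normrZ ger0_norm// -[leRHS]mulr1 ler_wpM2l.
set S := \sum_(y <- l) a y *: v y in IHF IHn *.
have [->|axn0] := eqVneq (a x) 0; first by rewrite scale0r !add0r.
have := H x (z + S) (a x) xl axn0; rewrite [z + S]addrC addrK.
have -> : z + (a x *: v x + S) = S + z + a x *: v x.
  by rewrite addrA [z + _]addrC -addrA addrC [z + S]addrC.
rewrite [S + z]addrC => h; have {h} := h _ _ _.
rewrite lt_neqAle eq_sym axn0 ax0 => h.
have := h ltac:(lra) isT ltac:(lra).
by rewrite mulrDr mulNr; lra.
Qed.

Lemma seq_pos_lower_bound l (d : X -> R) : (forall x, x \in l -> 0 < d x) ->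
  exists2 s : R, 0 < s & forall x, x \in l -> s <= d x.
Proof.
elim: l => [|x l IH] dl; first by exists 1.
have [|s s0 sl] := IH; first by move=> y yl; apply: dl; rewrite in_cons yl orbT.
exists (Num.min s (d x)); first by rewrite lt_min s0 dl// mem_head.
move=> y; rewrite in_cons => /predU1P[->|/sl sy].
  by rewrite ge_min lexx orbT.
by rewrite ge_min sy.
Qed.

Lemma continuous_sum {T : topologicalType} {V : normedModType R} l
    (f : X -> T -> V) : (forall x, continuous (f x)) ->
  continuous (fun z => \sum_(x <- l) f x z).
Proof.
move=> fc; elim: l => [|x l IH].
  by under eq_fun do rewrite big_nil; move=> z; exact: cvg_cst.
under eq_fun do rewrite big_cons; move=> z.
by apply: cvgD; [exact: fc|exact: IH].
Qed.

Definition bump (x : X) (d : R) (z : X) : R :=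
  Num.max 0 (Num.min 1 (2 - `|z - x| / d)).

Lemma bump_ge0 x d z : 0 <= bump x d z.
Proof. by rewrite /bump le_max lexx. Qed.

Lemma bump_eq1 x d z : 0 < d -> `|z - x| <= d -> bump x d z = 1.
Proof.
move=> d0 zx; have : `|z - x| / d <= 1 by rewrite ler_pdivrMr// mul1r.
by move=> h; rewrite /bump min_l ?max_r//; lra.
Qed.

Lemma bump_neq0 x d z : 0 < d -> bump x d z != 0 -> `|z - x| < d * 2.
Proof.
move=> d0; rewrite ltNge; apply: contra => zx; apply/eqP.
have : 2 <= `|z - x| / d by rewrite ler_pdivlMr// mulrC.
move=> h; rewrite /bump min_r; last by lra.
by rewrite max_l//; lra.
Qed.

Lemma continuous_bump x d : continuous (bump x d).
Proof.
move=> z.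
apply: (@continuous_max R X (fun=> 0) (fun z => Num.min 1 (2 - `|z - x| / d))).
  exact: cvg_cst.
apply: (@continuous_min R X (fun=> 1) (fun z => 2 - `|z - x| / d)).
  exact: cvg_cst.
apply: cvgB; first exact: cvg_cst.
apply: cvgM; last exact: cvg_cst.
apply: cvg_norm; apply: cvgB; [exact: cvg_id|exact: cvg_cst].
Qed.

(* The normalised bumps sum to 1 on [A] and the descent directions are applied
   one after the other, so the directional derivative need not be convex. *)
Lemma deformation F (A : set X) (b k : R) : compact A -> continuous F -> 0 <= k ->
  (forall x, A x -> b < F x /\ exists v, `|v| <= 1 /\ increment_bound F x v (- k)) ->
  exists2 s0 : R, 0 < s0 & forall s, 0 < s -> s < s0 -> exists D : X -> X,
    [/\ continuous D, (forall x, `|D x - x| <= s),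
        (forall x, F (D x) <= F x), (forall x, A x -> F (D x) <= F x - k * s) &
        forall x, F x <= b -> D x = x].
Proof.
move=> cA cF k0 H.
(* The estimates hold on three times the radius [p.1]: the bump reaches out to [2 * p.1], and the
   successive moves add at most [s < p.1]. *)
have /choice[dv dvP] (x : X) : exists p : R * X, A x ->
    [/\ 0 < p.1, `|p.2| <= 1, (forall z, `|z - x| < p.1 * 3 -> b < F z) &
     forall z t, `|z - x| < p.1 * 3 -> 0 < t -> t < p.1 * 3 ->
       F (z + t *: p.2) - F z <= - k * t].
  have [Ax|nAx] := pselect (A x); last by exists (0, 0).
  have [bF [v [v1 [d d0 Hd]]]] := H x Ax.
  have /nbhs_ballP[e /= e0 He] : \forall z \near x, b < F z.
    by have /cvgr_gt := cF x; exact.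
  exists (Num.min d e / 3, v) => _ /=; rewrite divfK//; split => //.
  - by rewrite divr_gt0// lt_min d0.
  - move=> z; rewrite lt_min => /andP[_ ze]; apply: He.
    by rewrite -ball_normE /ball_ /= distrC.
  - by move=> z t; rewrite !lt_min => /andP[zd _] t0 /andP[td _]; exact: Hd.
pose d x := (dv x).1; pose v x := (dv x).2.
have := cA; rewrite compact_cover => /(_ X A (fun x => ball x (d x))).
have ballo (x : X) : A x -> open (ball x (d x)).
  by move=> Ax; apply: ball_open; have [] := dvP x Ax.
have Acov : A `<=` cover A (fun x => ball x (d x)).
  by move=> x Ax; exists x => //; apply: ballxx; have [] := dvP x Ax.
move=> /(_ ballo Acov)[D' D'A AD'].
pose l : seq X := finmap.enum_fset D'.
have lA x : x \in l -> A x by move=> /D'A; rewrite inE.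
have [s0 s00 s0l] : exists2 s : R, 0 < s & forall x, x \in l -> s <= d x.
  by apply: seq_pos_lower_bound => x /lA /dvP[].
exists s0 => // s sp ss0.
pose sg z := \sum_(x <- l) bump x (d x) z.
(* The maximum with 1 keeps the quotient continuous everywhere; on [A] one has [sg z >= 1], so the
   coefficients there add up to exactly [s]. *)
pose N z := Num.max 1 (sg z).
have N1 z : 1 <= N z by rewrite le_max lexx.
have N0 z : 0 < N z by rewrite (lt_le_trans _ (N1 z)).
pose a z x := s * (bump x (d x) z / N z).
have a0 z x : 0 <= a z x by rewrite mulr_ge0 ?divr_ge0 ?bump_ge0// ltW.
have suma z : \sum_(x <- l) a z x = s * (sg z / N z).
  by rewrite -mulr_sumr -mulr_suml.
have sumas z : \sum_(x <- l) a z x <= s.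
  rewrite suma -[leRHS]mulr1; apply: ler_wpM2l; first exact: ltW.
  by rewrite ler_pdivrMr// mul1r le_max lexx orbT.
have near z x : x \in l -> a z x != 0 -> `|z - x| < d x * 2.
  move=> xl axz; apply: bump_neq0; first by have [] := dvP x (lA x xl).
  by apply: contra axz; rewrite /a => /eqP ->; rewrite mul0r mulr0.
have sd x : x \in l -> s < d x by move=> /s0l; exact: lt_le_trans.
have key z : F (z + \sum_(x <- l) a z x *: v x) <= F z - k * \sum_(x <- l) a z x /\
    `|\sum_(x <- l) a z x *: v x| <= \sum_(x <- l) a z x.
  apply: descent_sum (sumas z) => //.
    by move=> x /lA /dvP[].
  move=> x w t xl axz wz t0 ts; have [dx0 _ _ Hx] := dvP x (lA x xl).
  have := near z x xl axz; have := sd x xl; rewrite /d => h1 h2.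
  apply: Hx => //; last by lra.
  apply: le_lt_trans (ler_distD z w x) _; lra.
exists (fun z => z + \sum_(x <- l) a z x *: v x); split.
- have sgc : continuous sg by apply: continuous_sum => x; exact: continuous_bump.
  have Nc : continuous N.
    move=> z; apply: (@continuous_max R X (fun=> 1) sg); last exact: sgc.
    exact: cvg_cst.
  move=> z; apply: cvgD; first exact: cvg_id.
  apply: (continuous_sum l (fun x z => a z x *: v x)) => x {}z.
  apply: cvgZr_tmp; apply: cvgM; first exact: cvg_cst.
  apply: cvgM; first exact: continuous_bump.
  by apply: cvgV; [rewrite gt_eqF|exact: Nc].
- move=> z; rewrite addrAC subrr add0r; apply: le_trans (key z).2 _; exact: sumas.
- move=> z; apply: le_trans (key z).1 _; rewrite gerBl mulr_ge0//.
  exact: sumr_ge0.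
- move=> z Az; apply: le_trans (key z).1 _; rewrite suma.
  have sg1 : 1 <= sg z.
    have [x /= xl zx] := AD' z Az.
    have {}xl : x \in l by [].
    rewrite /sg (big_rem x)//= bump_eq1 ?lerDl ?sumr_ge0//.
    + by move=> y _; exact: bump_ge0.
    + by have [] := dvP x (lA x xl).
    + by apply: ltW; move: zx; rewrite -ball_normE /ball_ /= distrC.
  by rewrite /N max_r// divff ?mulr1// gt_eqF// (lt_le_trans _ sg1).
(* [F] exceeds [b] wherever a bump is active, so all coefficients vanish at [z]. *)
- move=> z Fz; rewrite big_seq big1 ?addr0// => x xl.
  have [->|axz] := eqVneq (a z x) 0; first by rewrite scale0r.
  have [dx0 _ Fx _] := dvP x (lA x xl).
  have := near z x xl axz; rewrite /d => h.
  have h3 : (dv x).1 * 2 < (dv x).1 * 3 by rewrite ltr_pM2l// ltr_nat.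
  by have := Fx z (lt_trans h h3); rewrite ltNge Fz.
Qed.

End Deformation.

(** * Min-max over paths *)

Section Minimax.
Context {R : realType} {X : completeNormedModType R} {K : topologicalType}.

(** The increments of the bounded sequence [r] dominate those of [u] uniformly in [t]; the point
    [t0] serves to deduce that [r] is nondecreasing. *)
Lemma uniform_limit (u : nat -> K -> X) (r : nat -> R) (M : R) (t0 : K) :
  (forall n m, (n <= m)%N -> forall t, `|u m t - u n t| <= r m - r n) ->
  (forall n, r n <= M) -> (forall n, continuous (u n)) ->
  exists g rs, [/\ continuous g, (forall n, r n <= rs),
    (forall n e, 0 < e -> exists2 m, (n <= m)%N & rs - r m < e) &
    forall n t, `|g t - u n t| <= rs - r n].
Proof.
move=> ur rM uc.
have rmono n m : (n <= m)%N -> r n <= r m.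
  by move=> nm; rewrite -subr_ge0; exact: le_trans (ur n m nm t0).
have supr : has_sup (range r).
  by split; [exists (r 0%N), 0%N | exists M => _ [n _ <-]].
pose rs := sup (range r).
have rle n : r n <= rs by apply: ub_le_sup; [exact: supr.2|exists n].
have radh n e : 0 < e -> exists2 m, (n <= m)%N & rs - r m < e.
  move=> e0; have [_ [k _ <-] ke] := sup_adherent e0 supr.
  exists (maxn n k); first exact: leq_maxl.
  by have := rmono _ _ (leq_maxr n k); move: ke; rewrite -/rs; lra.
have ucvg t : cvg (u n t @[n --> \oo]).
  apply/cauchy_cvgP/cauchy_exP => e e0; have [n1 _ n1e] := radh 0%N e e0.
  exists (u n1 t); exists n1 => // m /= n1m.
  rewrite -ball_normE /ball_ /= distrC; apply: le_lt_trans (ur n1 m n1m t) _.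
  by have := rle m; lra.
pose g t := lim (u n t @[n --> \oo]).
have gu n t : `|g t - u n t| <= rs - r n.
  apply/ler_addgt0Pr => e e0.
  have /cvgrPdist_lt/(_ e e0)[N _ HN] := ucvg t.
  have := HN (maxn N n) (leq_maxl _ _); rewrite -/(g t) => h1.
  have := ur n (maxn N n) (leq_maxr _ _) t; have := rle (maxn N n).
  by have := ler_distD (u (maxn N n) t) (g t) (u n t); move: h1; lra.
exists g, rs; split => // t; apply/cvgrPdist_lt => e e0.
have e3 : 0 < e / 3 by rewrite divr_gt0.
have [n _ ne] := radh 0%N _ e3.
have /cvgrPdist_lt/(_ _ e3) := uc n t; apply: filterS => s us.
have h1 := gu n t; have := gu n s; rewrite distrC => h2.
have := ler_distD (u n t) (g t) (g s).
have := ler_distD (u n s) (u n t) (g s).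
by move: us h1 h2 ne; lra.
Qed.

Definition path_max (F : X -> R) (C : set K) (g : K -> X) : R :=
  sup [set F (g t) | t in C].

(** Paths are defined on all of [K], so that continuity is not relative to [C]; as [K] need not be
    compact, boundedness is demanded separately. *)
Definition admissible (B : set K) (g0 g : K -> X) :=
  [/\ continuous g, (forall t, B t -> g t = g0 t) & exists r, forall t, `|g t| <= r].

Definition minimax (F : X -> R) (C B : set K) (g0 : K -> X) : R :=
  inf [set path_max F C g | g in admissible B g0].

Section PathMax.
Variables (F : X -> R) (C : set K) (g : K -> X).
Hypotheses (cF : continuous F) (cC : compact C) (cg : continuous g).

Lemma path_max_ge t : C t -> F (g t) <= path_max F C g.
Proof.
move=> Ct; apply: ub_le_sup; last by exists t.
have cFg : {within C, continuous (F \o g)}.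
  by apply: continuous_subspaceT => s; apply: continuous_comp; [exact: cg|exact: cF].
have [s _ sm] := compact_EVT_max (ex_intro _ t Ct) cC cFg.
by exists (F (g s)) => _ [t' Ct' <-]; apply: sm; rewrite inE.
Qed.

Lemma path_max_le M : C !=set0 -> (forall t, C t -> F (g t) <= M) ->
  path_max F C g <= M.
Proof.
move=> [t Ct] FM; apply: ge_sup; first by exists (F (g t)), t.
by move=> _ [s Cs <-]; exact: FM.
Qed.

End PathMax.

(* Brezis-Browder is applied to pairs [(g, r)]: [r] is a running bound of [g] and
   moving [g] by [s] must lower its maximum by [e * (G (r + s) - G r)].  As [G]
   is unbounded, this confines decreasing sequences without a weighted metric
   on [X]. *)
Lemma minimax_almost_critical (F : X -> R) (h : R -> R) (C B : set K)
    (g0 : K -> X) (b : R) : weight h -> locally_lipschitz (F : X -> R^o) ->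
  continuous F -> (forall x, 0 <= F x) -> compact C -> C !=set0 ->
  admissible B g0 g0 -> (forall t, B t -> F (g0 t) <= b) ->
  b < minimax F C B g0 ->
  forall e, 0 < e -> exists x, `|F x - minimax F C B g0| <= e /\
    clarke_slope F x * (1 + h `|x|) <= e.
Proof.
move=> wh FL cF F0 cC [t0 Ct0] adm0 FB bc.
have [G [Gmono Glip Gub]] := weight_potential h wh.
have [_ hmono h0 _] := wh.
set c := minimax F C B g0.
(* With [e] below the gap [c - b], points where [F >= c - e] lie above [b], so a deformation acting
   near them can fix the boundary values. *)
suff main e : 0 < e -> e < c - b -> exists x, `|F x - c| <= e /\
    clarke_slope F x * (1 + h `|x|) <= e.
  move=> e e0; have m0 : 0 < Num.min e ((c - b) / 2).
    by rewrite lt_min e0 divr_gt0// subr_gt0.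
  have [||x [Fx sx]] := main (Num.min e ((c - b) / 2)) => //.
    have : Num.min e ((c - b) / 2) <= (c - b) / 2 by rewrite ge_min lexx orbT.
    by move: m0 bc; rewrite -/c; lra.
  have mine : Num.min e ((c - b) / 2) <= e by rewrite ge_min lexx.
  by exists x; split; apply: le_trans mine.
move=> e0 ecb; apply: contrapT => nox.
have slope x : `|F x - c| <= e -> e < clarke_slope F x * (1 + h `|x|).
  by move=> Fx; rewrite ltNge; apply/negP => sx; apply: nox; exists x.
have Phi0 g : continuous g -> 0 <= path_max F C g.
  by move=> cg; apply: le_trans (path_max_ge F C g cF cC cg t0 Ct0).
have cPhi g : admissible B g0 g -> c <= path_max F C g.
  move=> ag; apply: ge_inf; last by exists g.
  by exists 0 => _ [g' [cg' _ _] <-]; exact: Phi0.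
pose T := {p : (K -> X) * R | [/\ continuous p.1,
  (forall t, B t -> p.1 t = g0 t) & forall t, `|p.1 t| <= p.2]}.
pose Phi (p : T) := path_max F C (sval p).1.
pose le (p q : T) := (forall t, `|(sval p).1 t - (sval q).1 t| <= (sval p).2 - (sval q).2) /\
  Phi p <= Phi q - e * (G (sval p).2 - G (sval q).2).
have r0 (p : T) : 0 <= (sval p).2.
  by have [_ _ pr] := svalP p; exact: le_trans (pr t0).
have ler (p q : T) : le p q -> (sval q).2 <= (sval p).2.
  by move=> [h1 _]; rewrite -subr_ge0; exact: le_trans (h1 t0).
have lePhi (p q : T) : le p q -> Phi p <= Phi q.
  move=> lpq; apply: le_trans lpq.2 _; rewrite gerBl mulr_ge0 ?(ltW e0)//.
  by rewrite subr_ge0 Gmono ?ler.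
have le_refl (p : T) : le p p.
  by split=> [t|]; rewrite !subrr ?normr0// mulr0 subr0.
have le_trans' (q p s : T) : le p q -> le q s -> le p s.
  move=> [h1 h2] [h3 h4]; split=> [t|].
    have := ler_distD ((sval q).1 t) ((sval p).1 t) ((sval s).1 t).
    by have := h1 t; have := h3 t; lra.
  by move: h2 h4; rewrite !mulrBr; lra.
have PhiT0 (p : T) : 0 <= Phi p by apply: Phi0; have [] := svalP p.
have lim (u : nat -> T) : (forall n, le (u n.+1) (u n)) ->
    exists a, forall n, le a (u n).
  move=> uS; have ule n m : (n <= m)%N -> le (u m) (u n).
    move=> /subnK <-; elim: (m - n)%N => [|k IH]; first exact: le_refl.
    by rewrite addSn; apply: le_trans' (uS _) IH.
  (* A radius beyond [M] would have cost more than [Phi (u 0)], whereas [Phi] stays nonnegative. *)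
  have [M M0 GM] := Gub (G (sval (u 0%N)).2 + Phi (u 0%N) / e).
  have rM n : (sval (u n)).2 <= M.
    rewrite leNgt; apply/negP => Mr.
    have G1 := Gmono _ _ M0 (ltW Mr); have [_ P1] := ule 0%N n (leq0n n).
    have P0 := PhiT0 (u n).
    have : e * (Phi (u 0%N) / e) < e * (G (sval (u n)).2 - G (sval (u 0%N)).2).
      by rewrite ltr_pM2l//; lra.
    by rewrite mulrCA divff ?gt_eqF// mulr1; lra.
  have [n m nm t|n|g [rs [cg rle radh gu]]] := uniform_limit (fun n => (sval (u n)).1)
      (fun n => (sval (u n)).2) M t0 _ rM.
  - by have [] := ule n m nm.
  - by have [] := svalP (u n).
  have gP : [/\ continuous (g, rs).1, (forall t, B t -> (g, rs).1 t = g0 t) &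
      forall t, `|(g, rs).1 t| <= (g, rs).2].
    split => //= [t Bt|t].
      apply/eqP; rewrite -subr_eq0 -normr_le0; apply/ler_addgt0Pr => d d0.
      have [m _ md] := radh 0%N d d0; have [_ um _] := svalP (u m).
      by rewrite -(um t Bt) add0r; apply: le_trans (gu m t) (ltW md).
    have [_ _ um] := svalP (u 0%N).
    have := ler_distD ((sval (u 0%N)).1 t) (g t) 0; rewrite !subr0.
    by have := gu 0%N t; have := um t; lra.
  exists (exist _ (g, rs) gP) => n; split => [t|] /=; first exact: gu.
  apply: path_max_le; first by exists t0.
  move=> t Ct; apply/ler_addgt0Pr => d d0.
  (* Two errors must fit into [d]: [k] from the continuity of [F] at [g t], and [e * k] from the
     cost of passing from the radius of a late [u m] to [rs]. *)
  have [k k0 kd] : exists2 k, 0 < k & (1 + e) * k <= d.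
    exists (d / (1 + e)); first by rewrite divr_gt0// addr_gt0.
    by rewrite mulrC divfK// gt_eqF// addr_gt0.
  have /cvgrPdist_lt/(_ k k0)/nbhs_ballP[j /= j0 Hj] := cF (g t).
  have [m nm mj] := radh n (Num.min k j) ltac:(by rewrite lt_min k0).
  move: mj; rewrite lt_min => /andP[mk mj].
  have Fgu : `|F (g t) - F ((sval (u m)).1 t)| < k.
    by apply: Hj; rewrite -ball_normE /ball_ /=; exact: le_lt_trans (gu m t) mj.
  have [cum _ _] := svalP (u m).
  have h1 := path_max_ge F C _ cF cC cum t Ct.
  have [_ h2] := ule n m nm; rewrite /Phi in h2.
  have h3 := Glip _ _ (r0 (u m)) (rle m).
  have h4 : (rs - (sval (u m)).2) / (1 + h (sval (u m)).2) <= rs - (sval (u m)).2.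
    have := h0 _ (r0 (u m)) => hm; rewrite ler_pdivrMr; last by lra.
    by rewrite ler_peMr// ?subr_ge0//; lra.
  have h5 : e * (G rs - G (sval (u m)).2) <= e * k.
    by rewrite ler_wpM2l ?(ltW e0)//; lra.
  move: Fgu; rewrite ltr_norml => /andP[_ Fgu].
  rewrite /Phi; rewrite mulrDl mul1r in kd; move: h2 h5; rewrite !mulrBr; lra.
have [_ [g ag <-] gce] : exists2 m, [set path_max F C g | g in admissible B g0] m & m < c + e.
  apply: inf_lt; first by exists (path_max F C g0), g0.
  by rewrite ltrDl.
have [cg Bg [r gr]] := ag.
have pP : [/\ continuous (g, r).1, (forall t, B t -> (g, r).1 t = g0 t) &
      forall t, `|(g, r).1 t| <= (g, r).2] by split.
have [p pa pmin] := brezis_browder le Phi 0 le_refl le_trans' PhiT0 lePhi lim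
  (exist _ (g, r) pP).
have [cp Bp pr] := svalP p; have rp0 := r0 p.
set q := (sval p).1 in cp Bp pr; set rp := (sval p).2 in pr rp0.
have Phip : Phi p <= c + e by apply: le_trans (lePhi _ _ pa) (ltW gce).
have cPhip : c <= Phi p by apply: cPhi; split => //; exists rp.
pose A := [set q t | t in C] `&` [set x | c - e <= F x].
have cA : compact A.
  apply: compact_closedI.
    by apply: continuous_compact => //; exact: continuous_subspaceT.
  by apply: (@preimage_closed _ _ F [set y | c - e <= y]) => //; exact: closed_ge.
have hrp : 0 < 1 + h rp by have := h0 _ rp0; lra.
(* As [|q t| <= rp] and [h] is nondecreasing, [k] is below the slope of [F] on all of [A]. It is
   also [e] times the bound on the growth of [G] beyond [rp], so the descent pays for the larger
   radius. *)
pose k := e / (1 + h rp).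
have k0 : 0 < k by rewrite divr_gt0.
have [|s0 s00 Hs] := deformation F A b k cA cF (ltW k0).
  move=> _ [[t Ct <-] /= Fqt]; split; first by lra.
  apply: clarke_descent => //; first exact: ltW.
  have Fle : F (q t) <= Phi p by exact: path_max_ge.
  have := slope (q t) ltac:(by rewrite ler_norml; apply/andP; split; lra).
  have hq : 0 < 1 + h `|q t| by have := h0 _ (normr_ge0 (q t)); lra.
  rewrite -ltr_pdivrMr// => sl; apply: le_lt_trans sl.
  rewrite /k ler_pM2l// lef_pV2 ?posrE// lerD2l.
  by apply: hmono (pr t); rewrite in_itv /= andbT.
(* [s < e / k] gives [k * s < e]: points of the path below [c - e], which may not descend, are then
   already below [Phi p - k * s]. *)
pose s := Num.min s0 (e / k) / 2.
have m0 : 0 < Num.min s0 (e / k) by rewrite lt_min s00 divr_gt0.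
have sp : 0 < s by rewrite divr_gt0.
have : s < Num.min s0 (e / k) by rewrite /s; lra.
rewrite lt_min => /andP[ss0]; rewrite ltr_pdivlMr// mulrC => ske.
have [D [cD Ds DF DA Db]] := Hs s sp ss0.
have p'P : [/\ continuous (D \o q, rp + s).1,
    (forall t, B t -> (D \o q, rp + s).1 t = g0 t) &
    forall t, `|(D \o q, rp + s).1 t| <= (D \o q, rp + s).2].
  split => /= [t|t Bt|t].
  - by apply: continuous_comp; [exact: cp|exact: cD].
  - by rewrite Bp// Db// FB.
  - have := ler_distD (q t) (D (q t)) 0; rewrite !subr0.
    by have := Ds (q t); have := pr t; lra.
pose p' : T := exist _ (D \o q, rp + s) p'P.
have Phip' : Phi p' <= Phi p - k * s.
  apply: path_max_le; first by exists t0.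
  move=> t Ct /=; have Fle : F (q t) <= Phi p by exact: path_max_ge.
  have [Fc|Fc] := leP (c - e) (F (q t)).
    have := DA (q t) ltac:(by split => //; exists t); lra.
  by have := DF (q t); lra.
have lep' : le p' p.
  split => [t|] /=; first by rewrite addrAC subrr add0r; exact: Ds.
  apply: le_trans Phip' _; rewrite lerD2l lerN2 /k mulrAC -mulrA.
  rewrite ler_wpM2l ?(ltW e0)//; apply: le_trans (Glip _ _ rp0 _) _.
    by rewrite lerDl ltW.
  by rewrite addrAC subrr add0r.
have := pmin p' lep'; have := mulr_gt0 k0 sp; move: Phip'; lra.
Qed.

End Minimax.

(** * Existence and uniqueness *)
Section GlobalInversion.
Context {R : realType}.

Lemma locally_lipschitz_continuous {X Y : normedModType R} (f : X -> Y) :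
  locally_lipschitz f -> continuous f.
Proof.
move=> fL x; have [U /nbhs_ballP[d /= d0 dU] [k fk]] := fL x.
apply/cvgrPdist_lt => e e0; apply/nbhs_ballP.
pose k' := 1 + Num.max 0 k.
have k0 : 0 < k' by rewrite ltr_pwDl// le_max lexx.
exists (Num.min d (e / k')); first by rewrite /= lt_min d0 divr_gt0.
move=> z; rewrite -ball_normE /ball_ /= lt_min => /andP[xzd xze].
have Uz : U z by apply: dU; rewrite -ball_normE.
have Ux : U x by apply: dU; exact: ballxx.
apply: le_lt_trans (fk (x, z) (conj Ux Uz)) _ => /=.
rewrite ltr_pdivlMr// mulrC in xze; apply: le_lt_trans xze.
by rewrite ler_wpM2r// /k' -[leLHS]add0r lerD// le_max lexx orbT.
Qed.

Context {X Y : completeNormedModType R}.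
Variables (f : X -> Y) (J : X -> set (blin X Y)) (y : Y) (h : R -> R).
Hypotheses (Jreg : forall x, regular_at J x) (chain : strong_chain_rule f J)
  (wh : weight h) (cps : weighted_CPS (dist_to f y) h).

Let F := dist_to f y.

Let F_lipschitz : locally_lipschitz (F : X -> R^o).
Proof. by apply: dist_to_locally_lipschitz; case: chain. Qed.

Let F_continuous : continuous F.
Proof. exact: (locally_lipschitz_continuous (F : X -> R^o) F_lipschitz). Qed.

Lemma almost_critical_value (c : R) :
  (forall e, 0 < e -> exists x, `|F x - c| <= e /\
    clarke_slope F x * (1 + h `|x|) <= e) ->
  c = 0 /\ exists p, f p = y.
Proof.
move=> crit; have [_ _ h0 _] := wh.
have /choice[u uP] (n : nat) : exists x, `|F x - c| <= n.+1%:R^-1 /\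
    clarke_slope F x * (1 + h `|x|) <= n.+1%:R^-1.
  by apply: crit; rewrite invr_gt0.
have slope0 x : 0 <= clarke_slope F x by apply: clarke_slope_ge.
have hP (x : X) : 1 <= 1 + h `|x| by rewrite lerDl h0.
have small (e : R) : 0 < e -> exists N, forall n, (N <= n)%N -> n.+1%:R^-1 < e.
  move=> e0; have [N _ HN] := near_infty_natSinv_lt (PosNum e0).
  by exists N => n; exact: HN.
have [||s smono [l ul]] := cps u.
- exists (`|c| + 1) => n; rewrite -/(F _); have := (uP n).1.
  have : n.+1%:R^-1 <= 1 :> R by rewrite invf_le1// ler1n.
  by have := ler_normD (F (u n) - c) c; rewrite subrK; move: (n.+1%:R^-1) => d; lra.
- apply/cvgrPdist_lt => e e0; have [N HN] := small e e0.
  exists N => // n /= Nn; rewrite sub0r normrN ger0_norm; last first.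
    by rewrite mulr_ge0// (le_trans ler01).
  exact: le_lt_trans (uP n).2 (HN n Nn).
have sn n : (n <= s n)%N.
  by elim: n => // n IH; exact: leq_ltn_trans IH (smono _ _ (ltnSn n)).
have Ful : F (u (s n)) @[n --> \oo] --> F l.
  by apply: (cvg_comp _ F ul); exact: F_continuous.
have Flc : F l = c.
  apply/eqP; rewrite -subr_eq0 -normr_le0; apply/ler_addgt0Pr => e e0.
  have e2 : 0 < e / 2 by rewrite divr_gt0.
  have /cvgrPdist_lt/(_ _ e2)[N1 _ H1] := Ful.
  have [N2 H2] := small _ e2; pose n := maxn N1 N2.
  have := H1 n (leq_maxl _ _); have := (uP (s n)).1.
  have := H2 (s n) (leq_trans (leq_maxr _ _) (sn n)).
  by have := ler_distD (F (u (s n))) (F l) c; rewrite add0r /=; move: ((s n).+1%:R^-1) => d; lra.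
have Fl0 : F l = 0.
  apply: contrapT => Fl.
  have Flpos : 0 < F l by rewrite lt_neqAle eq_sym normr_ge0 andbT; exact/eqP.
  have [r [d [r0 d0 Hd]]] := clarke_slope_regular f J y l chain (Jreg l).
  have /cvgrPdist_lt/(_ _ r0)[N1 _ H1] := ul.
  have /cvgr_gt/(_ _ Flpos)[N2 _ H2] := Ful.
  have [N3 H3] := small _ d0; pose n := maxn N1 (maxn N2 N3).
  have H1n := H1 n (leq_maxl _ _).
  have H2n := H2 n (leq_trans (leq_maxl _ _) (leq_maxr _ _)).
  have H3n := H3 (s n) (leq_trans (leq_trans (leq_maxr _ _) (leq_maxr _ _)) (sn n)).
  have := Hd (u (s n)); rewrite -ball_normE /ball_ /= => /(_ H1n) dle.
  have {}dle : d <= clarke_slope F (u (s n)).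
    by apply: dle => fu; move: H2n; rewrite /= /F /dist_to fu subrr normr0 ltxx.
  have := (uP (s n)).2; have := hP (u (s n)).
  by have := slope0 (u (s n)); move: H3n; move: ((s n).+1%:R^-1) => q; nra.
split; first by rewrite -Flc.
by exists l; apply/eqP; rewrite -subr_eq0 -normr_eq0; apply/eqP.
Qed.

Lemma solution_exists : exists x, f x = y.
Proof.
suff [] : minimax F [set (0 : R)] set0 (fun=> 0 : X) = 0 /\ exists p, f p = y by [].
apply: almost_critical_value.
(* The boundary is empty, so any level below [0 <= minimax] is allowed; -1 is one. *)
apply: (minimax_almost_critical F h [set (0 : R)] set0 _ (-1)) => //.
- by move=> x; exact: normr_ge0.
- exact: compact_set1.
- by exists 0.
- by split => //; [move=> t; exact: cvg_cst|exists 0 => t; rewrite normr0].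
- apply: (@lt_le_trans _ _ 0); first by lra.
  apply: lb_le_inf.
    exists (path_max F [set (0 : R)] (fun=> 0)), (fun=> 0) => //; split => //.
      by move=> t; exact: cvg_cst.
    by exists 0 => t; rewrite normr0.
  move=> _ [g [cg _ _] <-].
  apply: (@le_trans _ _ (F (g 0))); first exact: normr_ge0.
  by apply: path_max_ge => //; exact: compact_set1.
Qed.

Hypothesis fJ : pseudo_jacobian_map f J.

Lemma solution_unique x1 x2 : f x1 = y -> f x2 = y -> x1 = x2.
Proof.
move=> fx1 fx2; apply/eqP; apply/negPn/negP => x12.
have fc : continuous f by apply: locally_lipschitz_continuous; case: chain.
have d0 : 0 < `|x2 - x1| by rewrite normr_gt0 subr_eq0 eq_sym.
have [r [c [r0 c0 H]]] := regular_atP J x1 (Jreg x1).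
have expand := pseudo_jacobian_expanding f J x1 r c fc fJ (ltW c0)
  (fun T HT => isomorphism_expanding T c c0 (H T HT).1 (H T HT).2).
(* The sphere of radius [rho] must lie in the ball where [f] expands and leave [x2] outside. *)
pose rho := Num.min r `|x2 - x1| / 2.
have m0 : 0 < Num.min r `|x2 - x1| by rewrite lt_min r0.
have rho0 : 0 < rho by rewrite divr_gt0.
have : rho < Num.min r `|x2 - x1| by rewrite /rho; lra.
rewrite lt_min => /andP[rhor rhod].
have sphere x : `|x - x1| = rho -> c * rho <= F x.
  move=> xrho; rewrite -xrho /F /dist_to -fx1; apply: expand.
    exact: ballxx.
  by rewrite -ball_normE /ball_ /= distrC xrho.
(* Clamping the parameter extends the segment from [x1] to [x2] to a bounded path on the whole
   line. *)
pose clamp (t : R) := Num.max 0 (Num.min 1 t).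
have clamp_itv t : 0 <= clamp t <= 1.
  by rewrite /clamp le_max lexx /= ge_max ler01 ge_min lexx.
have clampc : continuous clamp.
  move=> t; apply: (@continuous_max R R (fun=> 0) (fun t => Num.min 1 t)).
    exact: cvg_cst.
  by apply: (@continuous_min R R (fun=> 1) id); [exact: cvg_cst|exact: cvg_id].
pose g0 t := x1 + clamp t *: (x2 - x1).
have g00 : g0 0 = x1.
  by rewrite /g0 /clamp min_r ?ler01// maxxx scale0r addr0.
have g01 : g0 1 = x2.
  by rewrite /g0 /clamp minxx max_r ?ler01// scale1r addrC subrK.
pose B : set R := [set 0; 1]; pose C : set R := `[0, 1]%classic.
have adm : admissible B g0 g0.
  split => //.
    move=> t; apply: cvgD; first exact: cvg_cst.
    by apply: cvgZr_tmp; exact: clampc.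
  exists (`|x1| + `|x2 - x1|) => t; apply: le_trans (ler_normD _ _) _.
  have /andP[c0' c1] := clamp_itv t.
  by rewrite lerD2l normrZ ger0_norm// ler_piMl.
have cC : compact C by exact: segment_compact.
have pass : c * rho <= minimax F C B g0.
  apply: lb_le_inf; first by exists (path_max F C g0), g0.
  move=> _ [g [cg gB _] <-].
  have [||t t01 gt] := @IVT R (fun t => `|g t - x1|) 0 1 rho ler01.
  - apply: continuous_subspaceT => t; apply: cvg_norm.
    by apply: cvgB; [exact: cg|exact: cvg_cst].
  - rewrite (gB 0); [|by left]; rewrite (gB 1); [|by right].
    rewrite g00 g01 subrr normr0 min_l// max_r//.
    by rewrite (ltW rho0) ltW.
  by apply: le_trans (sphere _ gt) _; exact: path_max_ge.
have [|zero _] := almost_critical_value (minimax F C B g0).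
  apply: (minimax_almost_critical F h C B g0 0) => //.
  - by move=> x; exact: normr_ge0.
  - by exists (0 : R); rewrite /C /= in_itv /= lexx ler01.
  - by move=> t [->|->]; rewrite /F /dist_to ?g00 ?g01 ?fx1 ?fx2 subrr normr0.
  - by apply: lt_le_trans pass; rewrite mulr_gt0.
by move: pass; rewrite zero; have := mulr_gt0 c0 rho0; lra.
Qed.

End GlobalInversion.

Theorem theorem15 (R : realType) (X Y : completeNormedModType R)
    (f : X -> Y) (Jf : X -> set (blin X Y)) (y : Y) :
  locally_lipschitz f ->
  pseudo_jacobian_map f Jf ->
  (forall x, regular_at Jf x) ->
  strong_chain_rule f Jf ->
  (exists2 h : R -> R, weight h & weighted_CPS (dist_to f y) h) ->
  exists! x, f x = y.
Proof.
move=> _ fJ Jreg chain [h wh cps].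
have [x fx] := solution_exists f Jf y h Jreg chain wh cps.
by exists x; split=> // x' fx'; exact: (solution_unique f Jf y h).
Qed.
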